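(* Given a solution $\Xi$ of the $U/K=\frac{\mathrm{O}(2n-1,1)}{\mathrm{O}(n)\times\mathrm{O}(n-1,1)}$-system defined by $\mathfrak{a}_p$ and a constant null vector $\mathbf{c}\in\mathbb{R}^{n-1,1}$, let $\Phi_\lambda$ be an extended flat frame for the Lax pair of $\Xi$. Then: (i) $\Phi_0=\begin{pmatrix}g_1&0\\0&g_2\end{pmatrix}$. (ii) Write $\mathbf{y}:=g_2^{-1}\mathbf{c}=(y_1,\dots,y_n)^T$ and $\Phi_1=(\mathbf{e}_1,\dots,\mathbf{e}_n,\mathbf{u}_1,\dots,\mathbf{u}_n)$. Then $F=\Phi_1\begin{pmatrix}0\\\mathbf{y}\end{pmatrix}$ is a flat immersion with degenerate flat normal bundle and constant multiplicities, $F$ is parameterised by line of curvature co-ordinates, $$\mathrm{I}_F=\sum_{i=1}^ny_i^2\,dx_i^2,\qquad \mathbb{II}_F=\sum_{i=1}^py_i\,dx_i^2\,\mathbf{u}_i+\sum_{j=p+1}^ny_j\,dx_j^2\,v,$$ and the curvature normals are $v_i=y_i^{-1}\mathbf{u}_i$ for $1\le i\le p$ and $v=\mathbf{u}_{n-1}+\mathbf{u}_n$.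
   Context: $J=\mathrm{I}_{n-1,1}=\operatorname{diag}(1,\dots,1,-1)$; $\mathbb{R}^{m,1}$ is $\mathbb{R}^{m+1}$ with $(x,y)=x^T\mathrm{I}_{m,1}y$. $\rho=\operatorname{diag}(\mathrm{I}_n,-\mathrm{I}_n)$, $\tau(g)=\rho g\rho^{-1}$, $\mathfrak{p}=\left\{\begin{pmatrix}0&\xi\\-J\xi^T&0\end{pmatrix}:\xi\in\mathfrak{gl}(n)\right\}\subset\mathfrak{o}(2n-1,1)$. Here $p$ is an integer with $n-p\ge2$ ($p$ is the number of rank-one curvature distributions and $n-p$ the rank of the remaining one). With $e_{ij}$ the elementary $n\times n$ matrices, put $$a_i=\begin{pmatrix}0&e_{ii}\\-Je_{ii}&0\end{pmatrix}\ (1\le i\le p),\qquad a_j=\begin{pmatrix}0&e_{j,n-1}-e_{jn}\\-(e_{n-1,j}+e_{nj})&0\end{pmatrix}\ (p+1\le j\le n).$$ $\mathfrak{a}_p=\langle a_1,\dots,a_n\rangle$ is a non-semisimple maximal abelian subalgebra of $\mathfrak{p}$; $\perp$ is with respect to the Killing form. The $U/K$-system defined by $\mathfrak{a}_p$, for $\Xi:\mathbb{R}^n\to\mathfrak{a}_p^\perp\cap\mathfrak{p}$, is $[a_i,\Xi_{x_j}]-[a_j,\Xi_{x_i}]-[[a_i,\Xi],[a_j,\Xi]]=0$, $i\neq j$. Its Lax pair is $\theta_\lambda=\sum_i(\lambda a_i+[a_i,\Xi])dx_i$. An extended flat frame is a solution $\Phi_\lambda:\mathbb{R}^n\times\mathbb{C}\to\mathrm{O}(2n-1,1,\mathbb{C})$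 of $\Phi_\lambda^{-1}d\Phi_\lambda=\theta_\lambda$ with $\overline{\Phi_\lambda}=\Phi_{\bar\lambda}$, $\tau\Phi_\lambda=\Phi_{-\lambda}$. $F$ maps into the light-cone of $\mathbb{R}^{2n-1,1}$; flat means that its induced metric $\mathrm{I}_F$ is flat. $\mathbb{II}_F$ is the normal-bundle valued second fundamental form. The normal bundle (in the trivial $\mathbb{R}^{2n-1,1}$-bundle) is flat if the normal connection is flat, and degenerate if it is not the case that the space of shape operators has dimension $n$ at each point. Curvature distributions are the common eigenspaces $E_i$ of the shape operators $A_w$ ($A_w$ = tangential part of $-dw$); curvature normals are defined by $A_w|_{E_i}=(w,v_i)\operatorname{Id}$ for all normal $w$. Constant multiplicities: the ranks of the curvature distributions are constant. Line of curvature co-ordinates: every $\partial/\partial x_i$ lies in a curvature distribution.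
   Formalization: For j>p, y_j is replaced by z=y_{n-1}-y_n; II_F gets a minus sign; the curvature normals become -y_i^{-1}u_i and -z^{-1}(u_{n-1}+u_n); (ii) is asserted on nonempty open sets where z and all y_i (i<=p) are nonzero, i.e. where F is an immersion. *)

(* Defs.v *)
From HB Require Import structures.
From mathcomp Require Import all_boot all_order all_algebra.
From mathcomp Require Import all_classical all_reals all_analysis.
From mathcomp.real_closed Require Import complex.
Import Order.TTheory GRing.Theory Num.Theory.
Import numFieldNormedType.Exports.

Set Implicit Arguments.
Unset Strict Implicit.
Unset Printing Implicit Defensive.

Local Open Scope classical_set_scope.
Local Open Scope ring_scope.

(* MathComp-Analysis, over an arbitrary realType.  Indices are 0-based:
   the ordinal of value i - 1 stands for the index i in 1, ..., n. *)

Section LorentzAlgebra.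

Definition Ilor (K : pzRingType) (N : nat) : 'M[K]_N :=
  diag_mx (\row_i (if i.+1 == N :> nat then -1 else 1)).

Definition lor (K : pzRingType) (N : nat) (v w : 'cV[K]_N) : K :=
  (v^T *m Ilor K N *m w) 0 0.

Definition in_O (K : pzRingType) (N : nat) (g : 'M[K]_N) : Prop :=
  g^T *m Ilor K N *m g = Ilor K N.

Definition rho (K : pzRingType) (n : nat) : 'M[K]_(n + n) :=
  block_mx 1%:M 0 0 (- 1%:M).

Definition tau (K : comUnitRingType) (n : nat) (g : 'M[K]_(n + n)) :
    'M[K]_(n + n) :=
  rho K n *m g *m invmx (rho K n).

Definition lie (K : pzRingType) (N : nat) (A B : 'M[K]_N) : 'M[K]_N :=
  A *m B - B *m A.

Variable R : realType.

Definition o_defect (N : nat) (Z : 'M[R]_N) : 'M[R]_N :=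
  Z^T *m Ilor R N + Ilor R N *m Z.

Lemma o_defect_is_linear (N : nat) : linear (@o_defect N).
Proof.
move=> a X Y; rewrite /o_defect linearP /= mulmxDl mulmxDr -scalemxAl -scalemxAr.
by rewrite scalerDr addrACA.
Qed.

HB.instance Definition _ (N : nat) :=
  GRing.isLinear.Build R 'M[R]_N 'M[R]_N *:%R (@o_defect N)
    (@o_defect_is_linear N).

(* the Lie algebra o(N-1,1), as a subspace of the N x N matrices *)
Definition o_alg (N : nat) : {vspace 'M[R]_N} := lker (linfun (@o_defect N)).

(* trace over U of an endomorphism f mapping U into itself *)
Definition trace_on (V : vectType R) (U : {vspace V}) (f : V -> V) : R :=
  \sum_(i < \dim U) coord (vbasis U) i (f (vbasis U)`_i).

(* Killing form of o(N-1,1) *)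
Definition killing (N : nat) (X Y : 'M[R]_N) : R :=
  trace_on (o_alg N) (fun Z => lie X (lie Y Z)).

Definition in_p (n : nat) (X : 'M[R]_(n + n)) : Prop :=
  exists xi : 'M[R]_n, X = block_mx 0 xi (- (Ilor R n *m xi^T)) 0.

End LorentzAlgebra.

Section AbelianSubalgebra.
Variables (R : realType) (n p : nat) (hnp : (1 < n - p)%N).

Fact penult_subproof : (n.-2 < n)%N.
Proof. by move: hnp; case: (n) => [|[|k]] //; rewrite sub0n. Qed.

Fact ultim_subproof : (n.-1 < n)%N.
Proof. by move: hnp; case: (n) => [|k] //; rewrite sub0n. Qed.

(* the last two 1-based indices n - 1 and n *)
Definition penult : 'I_n := Ordinal penult_subproof.
Definition ultim : 'I_n := Ordinal ultim_subproof.

Definition a_gen (i : 'I_n) : 'M[R]_(n + n) :=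
  if (i < p)%N
  then block_mx 0 (delta_mx i i) (- (Ilor R n *m delta_mx i i)) 0
  else block_mx 0 (delta_mx i penult - delta_mx i ultim)
                (- (delta_mx penult i + delta_mx ultim i)) 0.

Definition a_alg : {vspace 'M[R]_(n + n)} := <<codom a_gen>>%VS.

(* the orthogonal complement of a_p in p for the Killing form of o(2n-1,1) *)
Definition in_a_perp_p (X : 'M[R]_(n + n)) : Prop :=
  in_p X /\ forall Y, Y \in a_alg -> killing X Y = 0.

End AbelianSubalgebra.

Section Calculus.
Variables (R : realType) (n : nat).

Definition ddx (i : 'I_n) : 'rV[R]_n := delta_mx 0 i.

Definition partial (V : normedModType R) (k : 'I_n) (f : 'rV[R]_n -> V) :
    'rV[R]_n -> V :=
  fun x => 'D_(ddx k) f x.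

(* C^oo on U: all iterated partial derivatives are Frechet differentiable
   at the points of U; only meant for open U *)
Definition smooth_on (V : normedModType R) (U : set 'rV[R]_n)
    (f : 'rV[R]_n -> V) : Prop :=
  forall (s : seq 'I_n) (x : 'rV[R]_n), U x ->
    differentiable (foldr (@partial V) f s) x.

Definition mxRe (m : nat) (A : 'M[R[i]]_m) : 'M[R]_m :=
  map_mx (@complex.Re R) A.
Definition mxIm (m : nat) (A : 'M[R[i]]_m) : 'M[R]_m :=
  map_mx (@complex.Im R) A.
Definition mxC (m : nat) (A : 'M[R]_m) : 'M[R[i]]_m :=
  map_mx (@real_complex R) A.
Definition mxconj (m : nat) (A : 'M[R[i]]_m) : 'M[R[i]]_m :=
  map_mx (@conjc R) A.

Definition smoothC (m : nat) (f : 'rV[R]_n -> 'M[R[i]]_m) : Prop :=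
  smooth_on setT (fun x => mxRe (f x)) /\ smooth_on setT (fun x => mxIm (f x)).

Definition partialC (m : nat) (k : 'I_n) (f : 'rV[R]_n -> 'M[R[i]]_m)
    (x : 'rV[R]_n) : 'M[R[i]]_m :=
  \matrix_(r, s) (partial k (fun z => mxRe (f z)) x r s
                  +i* partial k (fun z => mxIm (f z)) x r s)%C.

End Calculus.

Section UKSystem.
Variables (R : realType) (n p : nat) (hnp : (1 < n - p)%N).
Implicit Types (Xi : 'rV[R]_n -> 'M[R]_(n + n)).

Definition UK_solution Xi : Prop :=
  [/\ smooth_on setT Xi,
      forall x, in_a_perp_p hnp (Xi x) &
      forall (i j : 'I_n) (x : 'rV[R]_n), i != j ->
        lie (a_gen R hnp i) (partial j Xi x)
        - lie (a_gen R hnp j) (partial i Xi x)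
        - lie (lie (a_gen R hnp i) (Xi x)) (lie (a_gen R hnp j) (Xi x)) = 0].

(* the dx_i-component of the Lax pair *)
Definition lax Xi (lam : R[i]) (i : 'I_n) (x : 'rV[R]_n) :
    'M[R[i]]_(n + n) :=
  lam *: mxC (a_gen R hnp i) + mxC (lie (a_gen R hnp i) (Xi x)).

Definition extended_flat_frame Xi
    (Phi : 'rV[R]_n -> R[i] -> 'M[R[i]]_(n + n)) : Prop :=
  [/\ forall x lam, in_O (Phi x lam),
      forall lam, smoothC (fun x => Phi x lam),
      forall lam (i : 'I_n) x,
        invmx (Phi x lam) *m partialC i (fun z => Phi z lam) x
        = lax Xi lam i x,
      forall x lam, mxconj (Phi x lam) = Phi x (conjc lam) &
      forall x lam, tau (Phi x lam) = Phi x (- lam)].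

End UKSystem.

Section Submanifolds.
Variables (R : realType) (n N : nat).
Implicit Types (U : set 'rV[R]_n) (F w : 'rV[R]_n -> 'cV[R]_N)
  (x X Y : 'rV[R]_n).

Definition in_lightcone (v : 'cV[R]_N) : Prop := lor v v = 0 /\ v != 0.

Definition immersion_on U F : Prop :=
  smooth_on U F /\ forall x, U x -> injective ('d F x).

(* first fundamental form *)
Definition fff F x X Y : R := lor ('d F x X) ('d F x Y).

Definition gram F x : 'M[R]_n :=
  \matrix_(i, j) fff F x (ddx R i) (ddx R j).

Definition christoffel F (k i j : 'I_n) x : R :=
  2^-1 * \sum_l invmx (gram F x) k l *
    (partial i (fun z => gram F z j l : R^o) x
     + partial j (fun z => gram F z i l : R^o) x
     - partial l (fun z => gram F z i j : R^o) x).

(* the l-th component of R(d_i, d_j) d_k *)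
Definition riemann F (l k i j : 'I_n) x : R :=
  partial i (christoffel F l j k : _ -> R^o) x
  - partial j (christoffel F l i k : _ -> R^o) x
  + \sum_m (christoffel F l i m x * christoffel F m j k x
            - christoffel F l j m x * christoffel F m i k x).

Definition flat_metric_on U F : Prop :=
  forall x, U x -> forall l k i j, riemann F l k i j x = 0.

(* Orthogonal projection onto the tangent space (meaningful when gram F x is
   invertible): tcoord F x v is the coordinate vector of the tangential part
   of v, i.e. the X with 'd F x X = v^T. *)
Definition tcoord F x (v : 'cV[R]_N) : 'rV[R]_n :=
  (\row_i lor ('d F x (ddx R i)) v) *m invmx (gram F x).
Definition tpart F x (v : 'cV[R]_N) : 'cV[R]_N := 'd F x (tcoord F x v).
Definition npart F x (v : 'cV[R]_N) : 'cV[R]_N := v - tpart F x v.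

Definition is_normal F x (v : 'cV[R]_N) : Prop :=
  forall X, lor ('d F x X) v = 0.

Definition normal_section U F w : Prop :=
  smooth_on U w /\ forall x, U x -> is_normal F x (w x).

(* second fundamental form, computed on constant vector fields *)
Definition sff F x X Y : 'cV[R]_N := npart F x ('D_X (fun z => 'D_Y F z) x).

Definition nconn F (i : 'I_n) w : 'rV[R]_n -> 'cV[R]_N :=
  fun x => npart F x (partial i w x).

Definition flat_normal_on U F : Prop :=
  forall w, normal_section U F w -> forall (i j : 'I_n) x, U x ->
    nconn F i (nconn F j w) x = nconn F j (nconn F i w) x.

(* matrix of the shape operator A_w (tangential part of - dw), acting on the
   right of row vectors *)
Definition shape F w x : 'M[R]_n :=
  \matrix_i tcoord F x (- partial i w x).

Definition shape_dim U F x (d : nat) : Prop :=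
  exists V : {vspace 'M[R]_n}, \dim V = d /\
    forall A, A \in V <-> exists2 w, normal_section U F w & A = shape F w x.

Definition degenerate_normal_on U F : Prop :=
  ~ (forall x, U x -> shape_dim U F x n).

(* E is a common eigenspace of the shape operators at x, with eigenvalues mu *)
Definition curv_distr U F x (E : {vspace 'rV[R]_n}) : Prop :=
  E <> 0%VS /\
  exists mu : ('rV[R]_n -> 'cV[R]_N) -> R, forall X,
    X \in E <-> forall w, normal_section U F w -> X *m shape F w x = mu w *: X.

Definition curv_normal U F x (E : {vspace 'rV[R]_n}) (v : 'cV[R]_N) : Prop :=
  [/\ curv_distr U F x E, is_normal F x v &
      forall w, normal_section U F w -> forall X, X \in E ->
        X *m shape F w x = lor (w x) v *: X].

Definition constant_multiplicities_on U F : Prop :=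
  exists (k : nat) (r : 'I_k -> nat), forall x, U x ->
    exists E : 'I_k -> {vspace 'rV[R]_n},
      [/\ injective E,
          forall V, curv_distr U F x V <-> exists i, V = E i &
          forall i, \dim (E i) = r i].

Definition line_of_curvature_on U F : Prop :=
  forall x, U x -> forall i : 'I_n,
    exists2 E, curv_distr U F x E & ddx R i \in E.

End Submanifolds.

(* Main.v *)
Require Import Defs.
From HB Require Import structures.
From mathcomp Require Import all_boot all_order all_algebra.
From mathcomp Require Import all_classical all_reals all_analysis.
From mathcomp Require Import ring lra zify.
From mathcomp.real_closed Require Import complex.
Import Order.TTheory GRing.Theory Num.Theory.
Import numFieldNormedType.Exports.
Local Open Scope classical_set_scope.
Local Open Scope ring_scope.

(** Let [J = diag (1, .., 1, -1)] be the signature matrix of size [n], and let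
    [nu_i] be the [i]-th basis vector if [i <= p] and the null vector
    [e_(n-1) + e_n] if [i > p].  Then every generator is
    [a_i = ((0, e_i nu_i^T J), (- nu_i e_i^T, 0))], with off-diagonal blocks of
    rank one.  The brackets [[a_i, Xi]] are block diagonal, with blocks [B_i] and
    [C_i] say.  Since the frame at the parameter 0 is fixed by [tau], it is
    [diag (g1, g2)], and [d_i g1 = g1 B_i], [d_i g2 = g2 C_i]; the frame at the
    parameter 1 satisfies [d_i Phi_1 = Phi_1 (a_i + diag (B_i, C_i))].  Both are
    real by the reality condition ([frame_adapted]).

    Everything else follows for an arbitrary frame of this kind
    ([adapted_frame]).  The vector [y = g2^-1 c] satisfies [d_i y = - C_i y], so
    the gauge terms cancel in the derivative of [F = Phi_1 (0, y)], and
    [d_i F = h_i Phi_1 (e_i, 0)] with [h_i = (nu_i, y)].  Thus [h_i] is [y_i] for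
    [i <= p] and [z = y_(n-1) - y_n] for [i > p]: these are the coefficients of
    the diagonal induced metric.  The product [(F, F) = (y, y) = (c, c)] vanishes.
    Differentiating once more, the normal part comes from the lower left block
    of [a_i] only, which gives the second fundamental form ([sff_F]).

    - Flatness of the metric ([flat_metric_F]).  The vector fields
      [f_i = h_i g1 e_i] have the scalar products of the [d_i F], and
      [d_i f_j = d_j f_i] because the second derivatives of [F] are symmetric.
      As the [f_i] form a basis of a space of dimension [n], the Christoffel
      symbols are the coordinates of [d_i f_j] in it, and the curvature tensor
      measures the failure of [d_i d_j f_k = d_j d_i f_k].

    - Flatness of the normal bundle ([flat_normal_F]).  A normal section is
      [Phi_1 (0, b)], and its normal derivative is
      [Phi_1 (0, g2^-1 d_i (g2 b))], so this is the symmetry of the second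
      derivatives of [g2 b].

    - Curvature distributions ([curv_normal_FP]).  The shape operator of
      [Phi_1 (0, b)] is diagonal with entries [- (nu_i, b) / h_i].  As [nu_i] is
      the same for all [i > p] and different directions are not proportional, the
      common eigenspaces are the first [p] coordinate lines and the span of the
      others, and the curvature normals are the [- h_i^-1 Phi_1 (0, nu_i)].  The
      shape operators span less than [n] dimensions because [n - p >= 2]
      ([degenerate_normal_F]).

    Both flatness statements thus rest on the symmetry of second derivatives of
    smooth matrix-valued maps ([schwarz], [smooth_partialC]). *)

(** * Symmetry of second derivatives *)

Section Schwarz.
Context {R : realType} {V : normedModType R}.
Implicit Types (f : V -> R) (x u v : V) (U : set V).

Lemma is_derive_line f x u (s : R) :
  differentiable f (s *: u + x) ->
  is_derive s 1 (fun t : R => f (t *: u + x)) ('D_u f (s *: u + x)).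
Proof.
move=> df.
have dl : is_diff s (fun t : R => t *: u + x) (fun t => t *: u).
  rewrite [X in is_diff _ X _](_ : _ = ( *:%R ^~ u) + cst x)//.
  by apply: is_diff_eq; rewrite addr0.
have dc : differentiable (f \o (fun t : R => t *: u + x)) s.
  exact: differentiable_comp.
apply: DeriveDef; first exact: diff_derivable.
by rewrite deriveE// diff_comp//= diff_val deriveE// scale1r.
Qed.

(** Two applications of the mean value theorem, first along [u], then along
    [v], express the second difference of [f] over a parallelogram by one value
    of the mixed derivative. *)
Lemma rectangle_mvt f x u v (h : R) : 0 < h ->
  (forall s t, 0 <= s <= h -> 0 <= t <= h ->
     differentiable f (s *: u + (t *: v + x)) /\
     differentiable ('D_u f) (s *: u + (t *: v + x))) ->
  exists s t, [/\ 0 <= s <= h, 0 <= t <= h &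
    f (h *: u + (h *: v + x)) - f (h *: u + x) - f (h *: v + x) + f x
      = 'D_v ('D_u f) (s *: u + (t *: v + x)) * h * h].
Proof.
move=> h0 df.
have hI : 0 <= h <= h by rewrite lexx ltW.
have oI : 0 <= (0 : R) <= h by rewrite lexx ltW.
have x0 : x = 0 *: v + x by rewrite scale0r add0r.
pose g s := f (s *: u + (h *: v + x)) - f (s *: u + x).
pose dg s := 'D_u f (s *: u + (h *: v + x)) - 'D_u f (s *: u + x).
have gd s : 0 <= s <= h -> is_derive s 1 g (dg s).
  move=> sI; apply: is_deriveB; apply: is_derive_line; first exact: (df _ _ sI hI).1.
  by have [] := df _ _ sI oI; rewrite -x0.
have cont (k dk : R -> R) : (forall s, 0 <= s <= h -> is_derive s 1 k (dk s)) ->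
    {within `[0, h], continuous k}.
  move=> kd; apply: derivable_within_continuous => s; rewrite in_itv/= => /kd ks.
  exact: ex_derive.
have sub s : s \in `]0, h[%R -> 0 <= s <= h.
  by rewrite in_itv/= => /andP[/ltW -> /ltW ->].
have [s /sub sI gE] := MVT h0 (fun s sI => gd s (sub s sI)) (cont _ _ gd).
pose k t := 'D_u f (t *: v + (s *: u + x)).
have kd t : 0 <= t <= h -> is_derive t 1 k ('D_v ('D_u f) (t *: v + (s *: u + x))).
  by move=> tI; apply: is_derive_line; rewrite addrCA; exact: (df _ _ sI tI).2.
have [t /sub tI kE] := MVT h0 (fun s sI => kd s (sub s sI)) (cont _ _ kd).
exists s, t; split => //.
have -> : f (h *: u + (h *: v + x)) - f (h *: u + x) - f (h *: v + x) + f x = g h - g 0.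
  by rewrite /g !scale0r !add0r opprD opprK !addrA.
rewrite gE subr0; congr (_ * _).
by move: kE; rewrite /k /dg !subr0 scale0r add0r addrCA => ->; rewrite addrCA.
Qed.

Lemma near_rectangle {P : set V} {x} u v : nbhs x P ->
  exists2 h : R, 0 < h & forall s t, 0 <= s <= h -> 0 <= t <= h ->
    P (s *: u + (t *: v + x)).
Proof.
move=> /nbhs_ballP[e /= e0 Pe].
pose M := `|u| + `|v| + 1.
have M0 : 0 < M by rewrite /M ltr_wpDl// addr_ge0.
exists (e / M); first exact: divr_gt0.
move=> s t /andP[s0 sh] /andP[t0 th]; apply: Pe.
rewrite -ball_normE/= addrA opprD addrCA subrr addr0 normrN.
apply: (le_lt_trans (ler_normD _ _)); rewrite !normrZ !ger0_norm//.
apply: (@le_lt_trans _ _ (e / M * (`|v| + `|u|))).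
  rewrite mulrDr addrC; apply: lerD; apply: ler_wpM2r => //.
by rewrite mulrAC ltr_pdivrMr// ltr_pM2l// addrC ltrDl.
Qed.

(** The second difference is symmetric in [u] and [v], so both mixed
    derivatives are limits of the same quotient as the parallelogram shrinks. *)
Lemma schwarz f x u v U : open U -> U x ->
  (forall z, U z -> [/\ differentiable f z, differentiable ('D_u f) z
                      & differentiable ('D_v f) z]) ->
  {for x, continuous ('D_v ('D_u f))} -> {for x, continuous ('D_u ('D_v f))} ->
  'D_v ('D_u f) x = 'D_u ('D_v f) x.
Proof.
move=> oU Ux df cvu cuv; apply/eqP; rewrite -subr_eq0 -normr_le0.
apply/ler_addgt0Pr => e e0; rewrite add0r.
have e2 : 0 < e / 2 by rewrite divr_gt0.
move/cvgrPdist_le : cvu => /(_ _ e2) nvu.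
move/cvgrPdist_le : cuv => /(_ _ e2) nuv.
have nU : nbhs x U by exact: open_nbhs_nbhs.
have [h h0 hP] := near_rectangle u v (filterI nU (filterI nvu nuv)).
have [s [t [sI tI E1]]] : exists s t, [/\ 0 <= s <= h, 0 <= t <= h &
    f (h *: u + (h *: v + x)) - f (h *: u + x) - f (h *: v + x) + f x
      = 'D_v ('D_u f) (s *: u + (t *: v + x)) * h * h].
  by apply: rectangle_mvt => // s t sI tI; have [/df[]] := hP _ _ sI tI.
have [t' [s' [tI' sI' E2]]] : exists t s, [/\ 0 <= t <= h, 0 <= s <= h &
    f (h *: v + (h *: u + x)) - f (h *: v + x) - f (h *: u + x) + f x
      = 'D_u ('D_v f) (t *: v + (s *: u + x)) * h * h].
  apply: rectangle_mvt => // s' t' sI' tI'; rewrite addrCA.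
  by have [/df[]] := hP _ _ tI' sI'.
move: E2; rewrite (addrCA (h *: v)) [X in X + _]addrAC E1 (addrCA (t' *: v)).
move=> /(mulIf (lt0r_neq0 h0))/(mulIf (lt0r_neq0 h0)) E.
have [_ [/= + _]] := hP _ _ sI tI; have [_ [_ /=]] := hP _ _ sI' tI'.
move: E; move: ('D_u ('D_v f) _) ('D_v ('D_u f) _) ('D_u ('D_v f) _) ('D_v ('D_u f) _).
move=> a b c d -> n1; rewrite distrC => n2.
by rewrite distrC [leRHS]splitr -(subrKA c) (le_trans (ler_normD _ _))// lerD.
Qed.

End Schwarz.

(** * Smooth matrix-valued maps *)

Section MatrixCalculus.
Context {R : realType} {V : normedModType R}.

Lemma differentiable_mxP {m k} {f : V -> 'M[R]_(m, k)} {x} :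
  differentiable f x <-> forall i j, differentiable (fun z => f z i j) x.
Proof.
split=> [df i j|df].
  apply: (@differentiable_comp _ _ _ _ f (fun N : 'M[R]_(m, k) => N i j)) => //.
  exact: differentiable_coord.
have -> : f = \sum_(i < m) \sum_(j < k) (fun z => f z i j *: delta_mx i j).
  apply/funext => z; rewrite fct_sumE [LHS]matrix_sum_delta.
  by apply: eq_bigr => i _; rewrite fct_sumE.
by do 2![apply: differentiable_sum => ?]; exact: differentiableZl.
Qed.

Lemma derive_mxE {m k} {f : V -> 'M[R]_(m, k)} {x v} i j :
  differentiable f x -> ('D_v f x) i j = 'D_v (fun z => f z i j) x.
Proof. by move=> /diff_derivable df; rewrite derive_mx// mxE. Qed.

Lemma differentiable_mulmx {m k l} (f : V -> 'M[R]_(m, k)) (g : V -> 'M[R]_(k, l)) x :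
  differentiable f x -> differentiable g x ->
  differentiable (fun z => f z *m g z) x.
Proof.
move=> /differentiable_mxP df /differentiable_mxP dg.
apply/differentiable_mxP => i j.
have -> : (fun z => (f z *m g z) i j)
    = \sum_(a < k) ((fun z => f z i a) * (fun z => g z a j)).
  by apply/funext => z; rewrite fct_sumE mxE.
by apply: differentiable_sum => a; exact: differentiableM.
Qed.

Lemma derive_mulmx {m k l} (f : V -> 'M[R]_(m, k)) (g : V -> 'M[R]_(k, l)) x v :
  differentiable f x -> differentiable g x ->
  'D_v (fun z => f z *m g z) x = 'D_v f x *m g x + f x *m 'D_v g x.
Proof.
move=> df dg; apply/matrixP => i j.
rewrite derive_mxE; last exact: differentiable_mulmx.
rewrite !mxE.
have -> : (fun z => (f z *m g z) i j)
    = \sum_(a < k) ((fun z => f z i a) * (fun z => g z a j)).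
  by apply/funext => z; rewrite fct_sumE mxE.
have dfe a b := diff_derivable (v := v) (differentiable_mxP.1 df a b).
have dge a b := diff_derivable (v := v) (differentiable_mxP.1 dg a b).
rewrite derive_sum => [|a]; last exact: derivableM.
rewrite -big_split/=; apply: eq_bigr => a _.
by rewrite deriveM// !derive_mxE// addrC; congr (_ + _); exact: mulrC.
Qed.

Lemma differentiable_trmx {m k} (f : V -> 'M[R]_(m, k)) x :
  differentiable f x -> differentiable (fun z => (f z)^T) x.
Proof.
move=> /differentiable_mxP df; apply/differentiable_mxP => i j.
by under eq_fun do rewrite mxE.
Qed.

Lemma derive_trmx {m k} (f : V -> 'M[R]_(m, k)) x v :
  differentiable f x -> 'D_v (fun z => (f z)^T) x = ('D_v f x)^T.
Proof.
move=> df; apply/matrixP => i j.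
rewrite derive_mxE; last exact: differentiable_trmx.
by rewrite mxE derive_mxE//; under eq_fun do rewrite mxE.
Qed.

End MatrixCalculus.

Section Smooth.
Context {R : realType} {n : nat}.
Implicit Types (U : set 'rV[R]_n).

Lemma partial_eq_on {V : normedModType R} {U} {f g : 'rV[R]_n -> V} {k x} :
  open U -> {in U, f =1 g} -> U x -> partial k f x = partial k g x.
Proof.
move=> oU fg Ux; apply: near_eq_derive.
by near=> z; apply: fg; rewrite inE; near: z; exact: open_nbhs_nbhs.
Unshelve. all: by end_near. Qed.

(** Differentiability is local: on an open set only the values there matter. *)
Lemma differentiable_eq_on {V : normedModType R} {U} {f g : 'rV[R]_n -> V} {x} :
  open U -> {in U, f =1 g} -> U x -> differentiable f x -> differentiable g x.
Proof.
move=> oU fg Ux df.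
have fgx : f x = g x by apply: fg; rewrite inE.
have cdf : continuous ('d f x) by exact: diff_continuous.
have dg : g \o shift x = cst (g x) + ('d f x : 'rV[R]_n -> V)
     +o_ (0 : 'rV[R]_n) (id : 'rV[R]_n -> 'rV[R]_n).
  have /eqaddoP fo := diff_locally df.
  apply/(@eqaddoP R 'rV[R]_n V 'rV[R]_n) => e e0; move: (fo e e0); apply: filter_app.
  have := near_shift 0 x U; rewrite subr0 => Ush.
  have : \forall z \near x, U z by exact: open_nbhs_nbhs.
  rewrite Ush; apply: filterS => h /= Uhx.
  suff -> : (f \o +%R^~ x - (cst (f x) + 'd f x)) h
    = (g \o +%R^~ x - (cst (g x) + 'd f x)) h by [].
  change (f (h + x) - (f x + 'd f x h) = g (h + x) - (g x + 'd f x h)).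
  by rewrite fgx fg// inE.
by apply/diff_locallyP; rewrite (diff_unique cdf dg).
Unshelve. all: by end_near. Qed.

(** All iterated partial derivatives of order at most [m] are differentiable on
    [U].  Unlike the definition of smoothness by sequences of indices, this
    form allows an induction on the order for sums and products. *)
Fixpoint differentiable_upto {V : normedModType R} U (m : nat)
    (f : 'rV[R]_n -> V) : Prop :=
  (forall x, U x -> differentiable f x) /\
  (if m is m'.+1 then forall k, differentiable_upto U m' (partial k f) else True).

Lemma smooth_partial {V : normedModType R} {U} {f : 'rV[R]_n -> V} {k} :
  smooth_on U f -> smooth_on U (partial k f).
Proof.
by move=> sf s x Ux; have := sf (rcons s k) x Ux; rewrite foldr_rcons.
Qed.

Lemma smooth_onP {V : normedModType R} {U} {f : 'rV[R]_n -> V} :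
  smooth_on U f <-> forall m, differentiable_upto U m f.
Proof.
split=> [sf m|df s].
  elim: m f sf => [|m IH] f sf; split => //; try exact: (sf [::]).
  by move=> k; apply: IH; exact: smooth_partial.
elim/last_ind: s f df => [|s k IH] f df x Ux; first exact: (df 0%N).1.
by rewrite foldr_rcons; apply: IH => // m; exact: (df m.+1).2.
Qed.

Lemma differentiable_upto_eq {V : normedModType R} {U} {f g : 'rV[R]_n -> V} {m} :
  open U -> {in U, f =1 g} -> differentiable_upto U m f -> differentiable_upto U m g.
Proof.
move=> oU; elim: m f g => [|m IH] f g fg [df pf]; split => //.
- by move=> x Ux; apply: (differentiable_eq_on _ fg Ux) => //; exact: df.
- by move=> x Ux; apply: (differentiable_eq_on _ fg Ux) => //; exact: df.
- move=> k; apply: IH (pf k) => x; rewrite inE => Ux.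
  exact: partial_eq_on oU fg Ux.
Qed.

Lemma differentiable_uptoW {V : normedModType R} {U} {f : 'rV[R]_n -> V} {m} :
  differentiable_upto U m.+1 f -> differentiable_upto U m f.
Proof.
elim: m f => [|m IH] f [df pf]; split => // k.
exact: IH (pf k).
Qed.

Lemma differentiable_uptoD {V : normedModType R} {U} {f g : 'rV[R]_n -> V} {m} :
  open U -> differentiable_upto U m f -> differentiable_upto U m g ->
  differentiable_upto U m (f + g).
Proof.
move=> oU; elim: m f g => [|m IH] f g [df pf] [dg pg]; split => //.
- by move=> x Ux; apply: differentiableD; [exact: df|exact: dg].
- by move=> x Ux; apply: differentiableD; [exact: df|exact: dg].
- move=> k; apply: (@differentiable_upto_eq _ _ (partial k f + partial k g)) => //.
    move=> x; rewrite inE => Ux; rewrite /partial deriveD//; apply: diff_derivable.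
    exact: df.
    exact: dg.
  by apply: IH; [exact: pf|exact: pg].
Qed.

Lemma differentiable_upto_mulmx {m k l U} (f : 'rV[R]_n -> 'M[R]_(m, k))
    (g : 'rV[R]_n -> 'M[R]_(k, l)) r :
  open U -> differentiable_upto U r f -> differentiable_upto U r g ->
  differentiable_upto U r (fun z => f z *m g z).
Proof.
move=> oU; elim: r f g => [|r IH] f g dmf dmg; split => //;
  try by move: dmf dmg => [df _] [dg _] x Ux;
         apply: differentiable_mulmx; [exact: df|exact: dg].
have [df pf] := dmf; have [dg pg] := dmg => j.
apply: (@differentiable_upto_eq _ _ ((fun z => partial j f z *m g z)
                                     + (fun z => f z *m partial j g z))) => //.
  by move=> x; rewrite inE => Ux; rewrite /partial derive_mulmx; [|exact: df|exact: dg].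
apply: differentiable_uptoD => //; apply: IH; [exact: (pf j)|exact: differentiable_uptoW|
  exact: differentiable_uptoW|exact: (pg j)].
Qed.

Lemma smooth_mulmx {m k l U} (f : 'rV[R]_n -> 'M[R]_(m, k))
    (g : 'rV[R]_n -> 'M[R]_(k, l)) :
  open U -> smooth_on U f -> smooth_on U g -> smooth_on U (fun z => f z *m g z).
Proof.
move=> oU /smooth_onP sf /smooth_onP sg; apply/smooth_onP => r.
exact: differentiable_upto_mulmx.
Qed.

Lemma smooth_cst {V : normedModType R} U (a : V) : smooth_on U (cst a : 'rV[R]_n -> V).
Proof.
apply/smooth_onP => m; elim: m a => [|m IH] a; split => // k.
have -> : partial k (cst a : 'rV[R]_n -> V) = cst 0.
  by apply/funext => x; exact: derive_cst.
exact: IH.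
Qed.

Lemma smooth_trmx {m k U} (f : 'rV[R]_n -> 'M[R]_(m, k)) :
  open U -> smooth_on U f -> smooth_on U (fun z => (f z)^T).
Proof.
move=> oU /smooth_onP sf; apply/smooth_onP => r; move: (sf r) => {sf}.
elim: r f => [|r IH] f [df pf]; split => //;
  try by move=> x Ux; apply: differentiable_trmx; exact: df.
move=> j; apply: (@differentiable_upto_eq _ _ (fun z => (partial j f z)^T)) => //.
  by move=> x; rewrite inE => Ux; rewrite /partial derive_trmx//; exact: df.
exact: IH (pf j).
Qed.

Lemma smooth_subset {V : normedModType R} {U U'} {f : 'rV[R]_n -> V} :
  U' `<=` U -> smooth_on U f -> smooth_on U' f.
Proof. by move=> UU sf s x /UU; exact: sf. Qed.

Lemma smooth_differentiable {V : normedModType R} {U} {f : 'rV[R]_n -> V} {x} :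
  smooth_on U f -> U x -> differentiable f x.
Proof. by move=> sf Ux; exact: (sf [::]). Qed.

Lemma smooth_partialC {m k U} (f : 'rV[R]_n -> 'M[R]_(m, k)) {i j x} :
  open U -> smooth_on U f -> U x ->
  partial i (partial j f) x = partial j (partial i f) x.
Proof.
move=> oU sf Ux.
have sd := smooth_differentiable.
apply/matrixP => a b.
have pE h (g : 'rV[R]_n -> 'M[R]_(m, k)) z : smooth_on U g -> U z ->
    partial h g z a b = partial h (fun z => g z a b) z.
  by move=> sg Uz; apply: derive_mxE; exact: sd sg Uz.
have eE h h' : {in U, (fun z => partial h (partial h' f) z a b)
    =1 partial h (partial h' (fun z => f z a b))}.
  move=> z; rewrite inE => Uz; rewrite pE//; last exact: smooth_partial.
  by apply: partial_eq_on oU _ Uz => t; rewrite inE => Ut; exact: pE.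
have xU : x \in U by rewrite inE.
(* the claim is scalar: [fun z => f z a b] is the function to which the
   symmetry theorem applies *)
apply: etrans (eE i j x xU) (etrans _ (esym (eE j i x xU))).
have de (g : 'rV[R]_n -> 'M[R]_(m, k)) z : smooth_on U g -> U z ->
    differentiable (fun z => g z a b) z.
  by move=> /sd sg /sg /differentiable_mxP.
have dp h z : U z -> differentiable (partial h (fun z => f z a b)) z.
  move=> Uz; apply: (@differentiable_eq_on _ _ (fun z => partial h f z a b) _ _ oU _ Uz).
    by move=> t; rewrite inE => Ut; exact: pE.
  by apply: de => //; exact: smooth_partial.
apply: (schwarz (fun z => f z a b) x (ddx R j) (ddx R i) U oU Ux).
- by move=> z Uz; split; [exact: de|exact: dp|exact: dp].
- apply: differentiable_continuous.
  apply: (differentiable_eq_on oU (eE i j) Ux).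
  by apply: de => //; do 2!apply: smooth_partial.
- apply: differentiable_continuous.
  apply: (differentiable_eq_on oU (eE j i) Ux).
  by apply: de => //; do 2!apply: smooth_partial.
Qed.

Lemma partial_mulmx {m k l} (f : 'rV[R]_n -> 'M[R]_(m, k))
    (g : 'rV[R]_n -> 'M[R]_(k, l)) i x :
  differentiable f x -> differentiable g x ->
  partial i (fun z => f z *m g z) x = partial i f x *m g x + f x *m partial i g x.
Proof. exact: derive_mulmx. Qed.

Lemma partial_trmx {m k} (f : 'rV[R]_n -> 'M[R]_(m, k)) i x :
  differentiable f x -> partial i (fun z => (f z)^T) x = (partial i f x)^T.
Proof. exact: derive_trmx. Qed.

Lemma partial_mxE {m k} (f : 'rV[R]_n -> 'M[R]_(m, k)) i x a b :
  differentiable f x -> (partial i f x) a b = partial i (fun z => f z a b) x.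
Proof. exact: derive_mxE. Qed.

Lemma partial_cst (V : normedModType R) (a : V) i x :
  partial i (cst a : 'rV[R]_n -> V) x = 0.
Proof. exact: derive_cst. Qed.

Lemma partial_mulmxl {m k l} (A : 'M[R]_(m, k)) (f : 'rV[R]_n -> 'M[R]_(k, l)) i x :
  differentiable f x -> partial i (fun z => A *m f z) x = A *m partial i f x.
Proof.
move=> df; rewrite /partial (derive_mulmx (cst A) f)//.
by rewrite derive_cst mul0mx add0r.
Qed.

Lemma differentiable_mulmxl {m k l} (A : 'M[R]_(m, k)) (f : 'rV[R]_n -> 'M[R]_(k, l)) x :
  differentiable f x -> differentiable (fun z => A *m f z) x.
Proof. by move=> df; exact: (differentiable_mulmx (cst A) f). Qed.

Lemma smooth_mulmxl {m k l} U (A : 'M[R]_(m, k)) (f : 'rV[R]_n -> 'M[R]_(k, l)) :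
  open U -> smooth_on U f -> smooth_on U (fun z => A *m f z).
Proof. by move=> oU sf; apply: (smooth_mulmx (cst A) f) => //; exact: smooth_cst. Qed.

(** The differential is determined by the partial derivatives. *)
Lemma diff_sum_partial {V : normedModType R} (f : 'rV[R]_n -> V) x X :
  differentiable f x -> 'd f x X = \sum_i X 0 i *: partial i f x.
Proof.
move=> df; rewrite {1}(row_sum_delta X) linear_sum; apply: eq_bigr => i _.
by rewrite linearZ /partial deriveE.
Qed.

End Smooth.

(** * The Lorentz product *)

Section LorentzAlgebra.
Context {R : realType}.

Lemma Ilor_sqr N : Ilor R N *m Ilor R N = 1%:M.
Proof.
rewrite /Ilor mulmx_diag -diag_const_mx; congr diag_mx.
apply/rowP => i; rewrite !mxE; case: ifP => _; last exact: mulr1.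
by rewrite mulrNN mulr1.
Qed.

Lemma tr_Ilor N : (Ilor R N)^T = Ilor R N.
Proof. exact: tr_diag_mx. Qed.

Lemma lor_mx N (v w : 'cV[R]_N) : v^T *m Ilor R N *m w = (lor v w)%:M.
Proof. exact: mx11_scalar. Qed.

Lemma lorC N (v w : 'cV[R]_N) : lor v w = lor w v.
Proof.
by rewrite /lor -[in LHS](trmxK (_ *m w)) mxE !trmx_mul trmxK tr_Ilor mulmxA.
Qed.

Lemma lorZr N (v w : 'cV[R]_N) a : lor v (a *: w) = a * lor v w.
Proof. by rewrite /lor -scalemxAr mxE. Qed.

Lemma lor0r N (v : 'cV[R]_N) : lor v 0 = 0.
Proof. by rewrite /lor mulmx0 mxE. Qed.

Lemma lor0l N (v : 'cV[R]_N) : lor 0 v = 0.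
Proof. by rewrite lorC lor0r. Qed.

Lemma lor_nondeg N (v w : 'cV[R]_N) : (forall b, lor b v = lor b w) -> v = w.
Proof.
have lorE (i : 'I_N) u : lor (Ilor R N *m delta_mx i 0) u = u i 0.
  rewrite /lor trmx_mul tr_Ilor trmx_delta -[_ *m _ *m Ilor R N]mulmxA Ilor_sqr.
  by rewrite mulmx1 -rowE mxE.
by move=> H; apply/colP => i; rewrite -!lorE H.
Qed.

Lemma lor_in_O N (g : 'M[R]_N) v w : in_O g -> lor (g *m v) (g *m w) = lor v w.
Proof.
move=> og; rewrite /lor trmx_mul !mulmxA.
by rewrite -(mulmxA v^T) -(mulmxA v^T) og.
Qed.

Lemma in_O_mulVmx N (g : 'M[R]_N) :
  in_O g -> (Ilor R N *m g^T *m Ilor R N) *m g = 1%:M.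
Proof. by move=> og; rewrite -!mulmxA (mulmxA g^T) og Ilor_sqr. Qed.

Lemma in_O_unit {N} {g : 'M[R]_N} : in_O g -> g \in unitmx.
Proof. by move=> /in_O_mulVmx/mulmx1_unit[]. Qed.

Lemma in_O_invmx N (g : 'M[R]_N) :
  in_O g -> invmx g = Ilor R N *m g^T *m Ilor R N.
Proof.
move=> og; rewrite -[RHS]mulmx1 -(mulmxV (in_O_unit og)) mulmxA.
by rewrite in_O_mulVmx// mul1mx.
Qed.

(** The negative direction lies in the second half of the coordinates. *)
Lemma Ilor_block n : (0 < n)%N ->
  Ilor R (n + n) = block_mx 1%:M 0 0 (Ilor R n).
Proof.
move=> n0; apply/matrixP => a b.
have nS (i : 'I_n) : (i.+1 == n + n)%N = false.
  by rewrite ltn_eqF// (leq_ltn_trans (ltn_ord i))// -[ltnLHS]addn0 ltn_add2l.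
have nS' (i : 'I_n) : ((n + i).+1 == n + n)%N = (i.+1 == n)%N.
  by rewrite -addnS eqn_add2l.
rewrite -(fintype.splitK a) -(fintype.splitK b).
case: (fintype.split a) => i; case: (fintype.split b) => j /=.
- by rewrite block_mxEul !mxE nS (inj_eq (@lshift_inj _ _)).
- by rewrite block_mxEur !mxE eq_lrshift.
- by rewrite block_mxEdl !mxE eq_rlshift.
- by rewrite block_mxEdr !mxE (inj_eq (@rshift_inj _ _)) /= nS'.
Qed.

End LorentzAlgebra.

(** * Immersions given by an adapted frame *)

Section CoordinateSubspaces.
Context {R : realType} {n : nat}.

(** Diagonal matrices with two equal diagonal entries span at most [n - 1]
    dimensions. *)
Lemma dim_diag_tied {V : {vspace 'M[R]_n}} {i j : 'I_n} : i != j ->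
  (forall A, A \in V -> exists d, A = diag_mx d /\ d 0 i = d 0 j) ->
  (\dim V < n)%N.
Proof.
move=> ij VP.
pose d k : 'M[R]_n := delta_mx k k + (if k == i then delta_mx j j else 0).
have sub : (V <= <<[seq d k | k <- enum (predC1 j)]>>)%VS.
  apply/subvP => A /VP[a [-> aij]].
  have -> : diag_mx a = \sum_(k | k != j) a 0 k *: d k.
    rewrite diag_mx_sum_delta (bigD1 j)//=.
    under [RHS]eq_bigr do rewrite scalerDr.
    rewrite big_split/= addrC; congr (_ + _).
    rewrite (bigD1 i)//= eqxx big1 ?addr0 ?aij// => k /andP[_ /negbTE ->].
    by rewrite scaler0.
  apply: memv_suml => k kj; apply: memvZ; apply: memv_span.
  by apply: map_f; rewrite mem_enum.
apply: (leq_ltn_trans (dimvS sub)); apply: (leq_ltn_trans (dim_span _)).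
rewrite size_map -cardE cardC1 card_ord.
by rewrite prednK// (leq_ltn_trans _ (ltn_ord i)).
Qed.

(** A sum of coordinate lines is cut out by the vanishing of the other
    coordinates. *)
Lemma mem_span_ddx (P : pred 'I_n) (X : 'rV[R]_n) :
  X \in (\sum_(j | P j) <[ddx R j]>)%VS <-> forall j, ~~ P j -> X 0 j = 0.
Proof.
split=> [/memv_sumP[v vP ->] j nPj|X0].
  rewrite summxE big1// => k Pk; have /vlineP[a ->] := vP k Pk.
  by rewrite !mxE/=; case: eqP nPj => [->|_ _]; rewrite ?Pk ?mulr0.
rewrite (row_sum_delta X) (bigID P)/= [X in _ + X]big1 ?addr0.
  by apply: memv_sumr => k Pk; apply: memvZ; exact: memv_line.
by move=> k /X0 ->; rewrite scale0r.
Qed.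

End CoordinateSubspaces.

Section AdaptedFrame.
Context {R : realType} {n : nat}.

(** The upper right and the lower left block of an element of [p], both of rank
    at most one.  This element sends the normal vector [b] to [(nu_i, b) e_i] and the
    tangent vector [a] to the normal vector [nu_i] times minus the [i]-th
    coordinate of [a]. *)
Definition tangent_block (nu : 'I_n -> 'cV[R]_n) (i : 'I_n) : 'M[R]_n :=
  delta_mx i (0 : 'I_1) *m ((nu i)^T *m Ilor R n).

Definition normal_block (nu : 'I_n -> 'cV[R]_n) (i : 'I_n) : 'M[R]_n :=
  - (nu i *m (delta_mx i (0 : 'I_1))^T).

(** A moving frame [Phi] of the Lorentz space whose derivatives have off-diagonal
    blocks of rank one in fixed directions [nu_i], and whose diagonal blocks [B]
    and [C] are both pure gauge: they are the logarithmic derivatives of [g1],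
    with values in the orthogonal group, and of [g2], with values in the Lorentz
    group.  The frame at the parameter 1 of the spectral family is of this kind,
    with [g1] and [g2] the diagonal blocks of the frame at the parameter 0. *)
Record adapted_frame (nu : 'I_n -> 'cV[R]_n)
    (Phi : 'rV[R]_n -> 'M[R]_(n + n)) (g1 g2 : 'rV[R]_n -> 'M[R]_n)
    (B C : 'I_n -> 'rV[R]_n -> 'M[R]_n) : Prop := {
  frame_smooth : smooth_on setT Phi;
  tangent_gauge_smooth : smooth_on setT g1;
  normal_gauge_smooth : smooth_on setT g2;
  frame_in_O : forall x, in_O (Phi x);
  tangent_gauge_orth : forall x, (g1 x)^T *m g1 x = 1%:M;
  normal_gauge_in_O : forall x, in_O (g2 x);
  partial_frame : forall i x, partial i Phi x
    = Phi x *m block_mx (B i x) (tangent_block nu i) (normal_block nu i) (C i x);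
  partial_tangent_gauge : forall i x, partial i g1 x = g1 x *m B i x;
  partial_normal_gauge : forall i x, partial i g2 x = g2 x *m C i x }.

End AdaptedFrame.

(* Below, partial derivatives are handled by the rules above only; unification
   must not unfold them into limits. *)
#[local] Opaque partial.

Section Frame.
Context {R : realType} {n : nat} (n0 : (0 < n)%N).
Context {nu : 'I_n -> 'cV[R]_n} {c : 'cV[R]_n}.
Context {Phi : 'rV[R]_n -> 'M[R]_(n + n)} {g1 g2 : 'rV[R]_n -> 'M[R]_n}.
Context {B C : 'I_n -> 'rV[R]_n -> 'M[R]_n}.
Hypothesis fr : adapted_frame nu Phi g1 g2 B C.

(* [e i], [al i], [be i]: basis vectors and off-diagonal blocks.  [y] is the
   constant vector [c] in the gauge [g2], [h i] are the Lame coefficients of the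
   immersion [F]. *)
Let e (i : 'I_n) : 'cV[R]_n := delta_mx i 0.
Let al := tangent_block nu.
Let be := normal_block nu.

Let sPhi := frame_smooth _ _ _ _ _ _ fr.
Let sg1 := tangent_gauge_smooth _ _ _ _ _ _ fr.
Let sg2 := normal_gauge_smooth _ _ _ _ _ _ fr.
Let oPhi := frame_in_O _ _ _ _ _ _ fr.
Let og1 := tangent_gauge_orth _ _ _ _ _ _ fr.
Let og2 := normal_gauge_in_O _ _ _ _ _ _ fr.
Let dPhi := partial_frame _ _ _ _ _ _ fr.
Let dg1 := partial_tangent_gauge _ _ _ _ _ _ fr.
Let dg2 := partial_normal_gauge _ _ _ _ _ _ fr.

Let y x : 'cV[R]_n := invmx (g2 x) *m c.
Let h i x : R := lor (nu i) (y x).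
Let F x : 'cV[R]_(n + n) := Phi x *m col_mx 0 (y x).

(* inclusions of the tangent half and of the normal half *)
Let up : 'M[R]_(n + n, n) := col_mx 1%:M 0.
Let dn : 'M[R]_(n + n, n) := col_mx 0 1%:M.

Let upE (a : 'cV[R]_n) : up *m a = col_mx a 0.
Proof. by rewrite mul_col_mx mul1mx mul0mx. Qed.
Let dnE (b : 'cV[R]_n) : dn *m b = col_mx 0 b.
Proof. by rewrite mul_col_mx mul1mx mul0mx. Qed.

Let openTT : open (setT : set 'rV[R]_n). Proof. exact: openT. Qed.

Let alE i (b : 'cV[R]_n) : al i *m b = lor (nu i) b *: e i.
Proof. by rewrite /al /tangent_block -mulmxA lor_mx mul_mx_scalar. Qed.

Let beE i (a : 'cV[R]_n) : be i *m a = - (a i 0 *: nu i).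
Proof.
rewrite /be /normal_block mulNmx -mulmxA trmx_delta -rowE.
by rewrite [row i a]mx11_scalar mxE mul_mx_scalar.
Qed.

Lemma lor_frame x (a a' b b' : 'cV[R]_n) :
  lor (Phi x *m col_mx a b) (Phi x *m col_mx a' b') = (a^T *m a') 0 0 + lor b b'.
Proof.
rewrite lor_in_O// /lor Ilor_block// tr_col_mx mul_row_block !mulmx0 mulmx1.
by rewrite addr0 add0r mul_row_col mxE.
Qed.

Lemma frame_inj x (a a' b b' : 'cV[R]_n) :
  Phi x *m col_mx a b = Phi x *m col_mx a' b' -> a = a' /\ b = b'.
Proof.
by move=> /(can_inj (mulKmx (in_O_unit (oPhi x)))) /eq_col_mx.
Qed.

Lemma frame_surj x (v : 'cV[R]_(n + n)) : exists a b, v = Phi x *m col_mx a b.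
Proof.
exists (usubmx (invmx (Phi x) *m v)), (dsubmx (invmx (Phi x) *m v)).
by rewrite vsubmxK mulKVmx// in_O_unit.
Qed.

Let dP x : differentiable Phi x.
Proof. exact: smooth_differentiable sPhi _. Qed.

Lemma partial_tangent (a : 'rV[R]_n -> 'cV[R]_n) i x : differentiable a x ->
  partial i (fun z => Phi z *m (up *m a z)) x
  = Phi x *m col_mx (B i x *m a x + partial i a x) (be i *m a x).
Proof.
move=> da; rewrite partial_mulmx//; last exact: differentiable_mulmxl.
rewrite dPhi partial_mulmxl// !upE -mulmxA mul_block_col !mulmx0 !addr0.
by rewrite -mulmxDr add_col_mx addr0.
Qed.

Lemma partial_normal (b : 'rV[R]_n -> 'cV[R]_n) i x : differentiable b x ->
  partial i (fun z => Phi z *m (dn *m b z)) x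
  = Phi x *m col_mx (al i *m b x) (C i x *m b x + partial i b x).
Proof.
move=> db; rewrite partial_mulmx//; last exact: differentiable_mulmxl.
rewrite dPhi partial_mulmxl// !dnE -mulmxA mul_block_col !mulmx0 !add0r.
by rewrite -mulmxDr add_col_mx addr0.
Qed.

(** The inverse in a Lorentz group is polynomial: [g^-1 = J g^T J]. *)
Lemma smooth_inv_in_O N (g : 'rV[R]_n -> 'M[R]_N) : (forall x, in_O (g x)) ->
  smooth_on setT g -> smooth_on setT (fun x => invmx (g x)).
Proof.
move=> og sg.
have -> : (fun x => invmx (g x)) = fun x => (Ilor R N *m (g x)^T) *m Ilor R N.
  by apply/funext => x; rewrite in_O_invmx.
apply: (smooth_mulmx _ (cst (Ilor R N))) => //; last exact: smooth_cst.
by apply: smooth_mulmxl => //; exact: smooth_trmx.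
Qed.

Lemma smooth_y : smooth_on setT y.
Proof.
apply: (smooth_mulmx (fun x => invmx (g2 x)) (cst c)) => //; last exact: smooth_cst.
exact: smooth_inv_in_O.
Qed.

Let dy x : differentiable y x.
Proof. exact: smooth_differentiable smooth_y _. Qed.

Lemma partial_g2mul (b : 'rV[R]_n -> 'cV[R]_n) i x : differentiable b x ->
  partial i (fun z => g2 z *m b z) x = g2 x *m (C i x *m b x + partial i b x).
Proof.
move=> db; rewrite partial_mulmx//; last exact: smooth_differentiable sg2 _.
by rewrite dg2 mulmxDr mulmxA.
Qed.

Lemma partial_g1mul (b : 'rV[R]_n -> 'cV[R]_n) i x : differentiable b x ->
  partial i (fun z => g1 z *m b z) x = g1 x *m (B i x *m b x + partial i b x).
Proof.
move=> db; rewrite partial_mulmx//; last exact: smooth_differentiable sg1 _.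
by rewrite dg1 mulmxDr mulmxA.
Qed.

(** [y] is parallel for the connection [C], because [g2 y] is constant. *)
Lemma partial_y i x : C i x *m y x + partial i y x = 0.
Proof.
have := partial_g2mul y i x (dy x).
have -> : (fun z => g2 z *m y z) = cst c.
  by apply/funext => z; rewrite mulKVmx// in_O_unit.
rewrite partial_cst => /esym.
by move=> /(congr1 (mulmx (invmx (g2 x)))); rewrite mulKmx ?in_O_unit// mulmx0.
Qed.

Let F_dn : F = fun z => Phi z *m (dn *m y z).
Proof. by apply/funext => z; rewrite dnE. Qed.

Lemma smooth_normal U (b : 'rV[R]_n -> 'cV[R]_n) : open U -> smooth_on U b ->
  smooth_on U (fun z => Phi z *m (dn *m b z)).
Proof.
move=> oU sb; apply: smooth_mulmx => //; last exact: smooth_mulmxl.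
exact: smooth_subset sPhi.
Qed.

Lemma smooth_F : smooth_on setT F.
Proof. by rewrite F_dn; apply: smooth_normal => //; exact: smooth_y. Qed.

Let dF x : differentiable F x.
Proof. exact: smooth_differentiable smooth_F _. Qed.

(** Hence the derivative of [F] has no normal component: the [i]-th one is
    [h i] times the [i]-th column of [Phi]. *)
Lemma partial_F i : partial i F = fun z => Phi z *m (up *m (al i *m y z)).
Proof. by apply/funext => x; rewrite F_dn partial_normal// partial_y upE. Qed.

Lemma derive_F X x : 'D_X F x = Phi x *m (up *m (\sum_i X 0 i *: al i *m y x)).
Proof.
rewrite deriveE// diff_sum_partial//.
under eq_bigr do rewrite partial_F scalemxAr scalemxAr scalemxAl.
by rewrite -mulmx_sumr -mulmx_sumr -mulmx_suml.
Qed.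

Lemma diff_F x X : 'd F x X = Phi x *m col_mx (\col_i (X 0 i * h i x)) 0.
Proof.
rewrite -deriveE// derive_F upE; congr (_ *m col_mx _ _).
apply/colP => k; rewrite summxE mxE (bigD1 k)//= -scalemxAl alE !mxE !eqxx mulr1.
rewrite big1 ?addr0// => j jk; rewrite -scalemxAl alE !mxE eq_sym (negbTE jk).
by rewrite /= !mulr0.
Qed.

Lemma ddx_col i x : \col_k (ddx R i 0 k * h k x) = h i x *: e i.
Proof.
apply/colP => k; rewrite !mxE eqxx andbT/= mulrC (eq_sym k).
by case: eqP => [->|]; rewrite ?mulr0.
Qed.

Lemma fff_F x X Y : fff F x X Y = \sum_i h i x ^+ 2 * (X 0 i * Y 0 i).
Proof.
rewrite /fff !diff_F lor_frame lor0r addr0 mxE.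
by apply: eq_bigr => i _; rewrite !mxE; ring.
Qed.

Lemma gram_F x : gram F x = diag_mx (\row_i h i x ^+ 2).
Proof.
apply/matrixP => i j; rewrite !mxE fff_F (bigD1 i)//= big1 ?addr0.
  by rewrite !mxE !eqxx/= mul1r mulr_natr.
by move=> k ki; rewrite !mxE (negbTE ki) andbF mul0r mulr0.
Qed.

Section Point.
Variables (x : 'rV[R]_n) (hx : forall i, h i x != 0).

Lemma invmx_gram_F : invmx (gram F x) = diag_mx (\row_i (h i x ^+ 2)^-1).
Proof.
have E : gram F x *m diag_mx (\row_i (h i x ^+ 2)^-1) = 1%:M.
  rewrite gram_F mulmx_diag -diag_const_mx; congr diag_mx; apply/rowP => i.
  by rewrite !mxE mulfV// expf_neq0.
by rewrite -[RHS]mul1mx -(mulVmx (mulmx1_unit E).1) -mulmxA E mulmx1.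
Qed.

Lemma tcoord_F a b : tcoord F x (Phi x *m col_mx a b) = \row_i (a i 0 / h i x).
Proof.
rewrite /tcoord invmx_gram_F mul_mx_diag; apply/rowP => i; rewrite !mxE.
rewrite diff_F ddx_col lor_frame linearZ/= -scalemxAl /e trmx_delta -rowE !mxE.
rewrite lor0l addr0 expr2 invfM mulrA [_ * a i 0]mulrC.
by rewrite -[a i 0 * _ / _]mulrA mulfV// mulr1.
Qed.

Lemma npart_F a b : npart F x (Phi x *m col_mx a b) = Phi x *m col_mx 0 b.
Proof.
rewrite /npart /tpart tcoord_F diff_F -mulmxBr opp_col_mx add_col_mx oppr0 addr0.
congr (_ *m col_mx _ _); apply/colP => i; rewrite !mxE divfK ?subrr//.
Qed.

(** The normal space is spanned by the last [n] columns of the frame. *)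
Lemma is_normal_FP v : is_normal F x v <-> exists b, v = Phi x *m col_mx 0 b.
Proof.
split=> [|[b ->] X]; last first.
  by rewrite diff_F lor_frame mulmx0 mxE lor0l addr0.
have [a [b ->]] := frame_surj x v => nv; exists b; congr (_ *m col_mx _ _).
apply/colP => i; have := nv (ddx R i); rewrite diff_F ddx_col lor_frame.
rewrite linearZ/= -scalemxAl /e trmx_delta -rowE !mxE lor0l addr0.
by move/eqP; rewrite mulf_eq0 (negbTE (hx i))/= => /eqP.
Qed.

Lemma diff_F_inj : injective ('d F x).
Proof.
move=> X Y; rewrite !diff_F => /frame_inj[+ _] => /colP E; apply/rowP => i.
by have := E i; rewrite !mxE => /(mulIf (hx i)).
Qed.

Lemma sff_F X Y : sff F x X Y
  = - \sum_i (h i x * (X 0 i * Y 0 i)) *: (Phi x *m col_mx 0 (nu i)).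
Proof.
rewrite /sff.
have -> : (fun z => 'D_Y F z) = fun z => Phi z *m (up *m ((\sum_i Y 0 i *: al i) *m y z)).
  by apply/funext => z; rewrite derive_F mulmx_suml.
set AY := \sum_i _; have dAY z : differentiable (fun z => AY *m y z) z.
  exact: differentiable_mulmxl.
rewrite deriveE; last first.
  by apply: differentiable_mulmx => //; exact: differentiable_mulmxl.
rewrite diff_sum_partial; last first.
  by apply: differentiable_mulmx => //; exact: differentiable_mulmxl.
have AYE k : (AY *m y x) k 0 = Y 0 k * h k x.
  rewrite mulmx_suml summxE (bigD1 k)//= -scalemxAl alE !mxE !eqxx mulr1.
  rewrite big1 ?addr0// => j jk; rewrite -scalemxAl alE !mxE eq_sym (negbTE jk).
  by rewrite /= !mulr0.
under eq_bigr do rewrite partial_tangent// scalemxAr scale_col_mx.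
rewrite -mulmx_sumr.
have sumcol (f g : 'I_n -> 'cV[R]_n) :
    \sum_i col_mx (f i) (g i) = col_mx (\sum_i f i) (\sum_i g i).
  elim/big_rec3: _ => [|i u v w _ ->]; first by rewrite col_mx0.
  by rewrite add_col_mx.
rewrite sumcol npart_F -dnE !mulmx_sumr -sumrN; apply: eq_bigr => i _.
rewrite beE AYE -dnE scalerN scalerA !mulmxN -!scalemxAr; congr (- (_ *: _)); ring.
Qed.

End Point.

(* The derivatives of [F] in the gauge [g1].  As [g1] is orthogonal, they have
   the same scalar products as those of [F], but take values in a fixed space of
   dimension [n]; their symmetry makes them the gradient of a flat chart. *)
Let f j z : 'cV[R]_n := g1 z *m (al j *m y z).

Let sf j : smooth_on setT (f j).
Proof. by apply: smooth_mulmx => //; apply: smooth_mulmxl => //; exact: smooth_y. Qed.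

Let df j x : differentiable (f j) x.
Proof. exact: smooth_differentiable (sf j) _. Qed.

(** This is the tangent part of the symmetry of the second derivatives of [F]. *)
Lemma partial_f_sym i j x : partial i (f j) x = partial j (f i) x.
Proof.
have dal k z : differentiable (fun z => al k *m y z) z by exact: differentiable_mulmxl.
have := smooth_partialC F (i := i) (j := j) openTT smooth_F (I : setT x).
rewrite !partial_F (partial_tangent _ i _ (dal j x)) (partial_tangent _ j _ (dal i x)).
move=> /frame_inj[E _].
by rewrite /f (partial_g1mul _ i _ (dal j x)) (partial_g1mul _ j _ (dal i x)) E.
Qed.

Lemma gram_f j l z : gram F z j l = ((f j z)^T *m f l z) 0 0.
Proof.
rewrite mxE /fff !diff_F !ddx_col lor_frame lor0r addr0 /f !alE.
by rewrite trmx_mul mulmxA -(mulmxA _ (g1 z)^T) og1 mulmx1.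
Qed.

(* [Q x i j l] is the component of the second derivative along [g1 e_l]. *)
Let Q x i j l : R := ((g1 x)^T *m partial i (f j) x) l 0.

Let Q_sym x i j l : Q x i j l = Q x j i l.
Proof. by rewrite /Q partial_f_sym. Qed.

Lemma partial_gram i j l x :
  partial i (fun z => gram F z j l : R^o) x = h l x * Q x i j l + h j x * Q x i l j.
Proof.
under eq_fun do rewrite gram_f.
have fE k S : ((f k x)^T *m S) 0 0 = h k x * ((g1 x)^T *m S) k (0 : 'I_1).
  rewrite /f alE -scalemxAr linearZ/= -scalemxAl mxE; congr (_ * _).
  by rewrite trmx_mul /e trmx_delta -mulmxA -rowE mxE.
have dft k : differentiable (fun z => (f k z)^T) x by exact: differentiable_trmx.
have dff : differentiable (fun z => (f j z)^T *m f l z) x by exact: differentiable_mulmx.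
rewrite -partial_mxE// partial_mulmx// partial_trmx// mxE; congr (_ + _).
  by rewrite -[in LHS](trmxK (f l x)) -trmx_mul mxE fE.
by rewrite fE.
Qed.

(** The Koszul formula, solved with the symmetry of the second derivatives: the
    Christoffel symbols are the coordinates of the derivatives of [f]. *)
Lemma christoffel_F k i j x : (forall i, h i x != 0) ->
  christoffel F k i j x = (h k x)^-1 * ((g1 x)^T *m partial i (f j) x) k 0.
Proof.
move=> hx; rewrite /christoffel invmx_gram_F// (bigD1 k)//= big1 ?addr0; last first.
  by move=> l lk; rewrite !mxE eq_sym (negbTE lk) mulr0n mul0r.
rewrite !partial_gram -/(Q x i j k) !mxE eqxx mulr1n.
have := Q_sym x; have := hx k; move: (Q x) (h k x) (h i x) (h j x) => q hk hi hj hk0 qs.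
rewrite (qs k i) (qs k j) (qs j i); by field.
Qed.

Section Open.
Context {U : set 'rV[R]_n} (oU : open U).
Hypothesis hU : forall x, U x -> forall i, h i x != 0.

(* [G] is the square matrix with columns [f l]; [partial_f_G] below says that
   the derivative of [f j] is [G] applied to the Christoffel symbols. *)
Let G z : 'M[R]_n := \matrix_(a, l) f l z a 0.
Let Gam i j z : 'cV[R]_n := \col_k christoffel F k i j z.

Let dG x : differentiable G x.
Proof.
apply/differentiable_mxP => a l; under eq_fun do rewrite mxE.
exact: differentiable_mxP.1 (df l x) a 0.
Qed.

Lemma differentiable_h k x : differentiable (h k) x.
Proof.
have dal : differentiable (fun z => al k *m y z) x by exact: differentiable_mulmxl.
have := differentiable_mxP.1 dal k 0; under eq_fun do rewrite alE !mxE !eqxx mulr1.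
by [].
Qed.

Lemma differentiable_christoffel k i j x : U x ->
  differentiable (christoffel F k i j : _ -> R^o) x.
Proof.
move=> Ux; apply: (@differentiable_eq_on _ _ _ _
  ((fun z => (h k z)^-1) * (fun z => ((g1 z)^T *m partial i (f j) z) k 0)) _ _ oU _ Ux).
  by move=> z; rewrite inE => Uz; rewrite christoffel_F//; exact: hU.
apply: differentiableM.
  by apply: differentiableV; [exact: differentiable_h|exact: hU].
apply: (differentiable_mxP.1 _ k 0).
apply: (differentiable_mulmx (fun z => (g1 z)^T)).
  by apply: differentiable_trmx; exact: smooth_differentiable sg1 _.
by apply: (smooth_differentiable (U := setT)) => //; exact: smooth_partial.
Qed.

Let dGam i j x : U x -> differentiable (Gam i j) x.
Proof.
move=> Ux; apply/differentiable_mxP => a b; under eq_fun do rewrite mxE.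
exact: differentiable_christoffel.
Qed.

Let partial_Gam i j k l x : U x ->
  partial i (christoffel F l j k : _ -> R^o) x = (partial i (Gam j k) x) l 0.
Proof.
move=> Ux; rewrite partial_mxE; last exact: dGam.
by under [in RHS]eq_fun do rewrite mxE.
Qed.

Let G_diag z : G z = g1 z *m diag_mx (\row_i h i z).
Proof.
apply/matrixP => a l; rewrite mul_mx_diag !mxE (bigD1 l)//= big1 ?addr0.
  by rewrite alE !mxE !eqxx mulr1.
by move=> k kl; rewrite alE !mxE (negbTE kl) !mulr0.
Qed.

Let g1_tr z : g1 z *m (g1 z)^T = 1%:M. Proof. exact: mulmx1C. Qed.

Let G_unit z : U z -> G z \in unitmx.
Proof.
move=> Uz; rewrite G_diag unitmx_mul (mulmx1_unit (g1_tr z)).1/=.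
rewrite unitmxE det_diag unitfE; apply/prodf_neq0 => i _; rewrite mxE; exact: hU.
Qed.

Let partial_f_G i j z : U z -> partial i (f j) z = G z *m Gam i j z.
Proof.
move=> Uz; rewrite G_diag -mulmxA.
have -> : diag_mx (\row_i h i z) *m Gam i j z = (g1 z)^T *m partial i (f j) z.
  apply/colP => k; rewrite mul_diag_mx !mxE christoffel_F//; last exact: hU.
  by rewrite mulrA mulfV ?mul1r ?mxE//; exact: hU.
by rewrite mulmxA g1_tr mul1mx.
Qed.

Let partial_G i z (v : 'cV[R]_n) : partial i G z *m v = \sum_l v l 0 *: partial i (f l) z.
Proof.
apply/colP => a; rewrite mxE summxE; apply: eq_bigr => l _; rewrite mxE mulrC.
rewrite partial_mxE// [in RHS]partial_mxE//.
by under eq_fun do rewrite mxE.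
Qed.

(** Differentiating [d_b f_k = G Gam_bk] once more, with [d_a G = G Gam_a], yields
    [d_a d_b f_k = G (d_a Gam_bk + Gam_a Gam_bk)].  The bracket, antisymmetrised in
    [a] and [b], is the curvature; it vanishes since [G] is invertible and the
    left-hand side is symmetric. *)
Lemma flat_metric_F : flat_metric_on U F.
Proof.
move=> x Ux l k i j; rewrite /riemann !partial_Gam//.
have E a b : partial a (partial b (f k)) x
    = G x *m (\sum_m Gam b k x m 0 *: Gam a m x + partial a (Gam b k) x).
  have -> : partial a (partial b (f k)) x = partial a (fun z => G z *m Gam b k z) x.
    by apply: (partial_eq_on oU _ Ux) => z; rewrite inE => Uz; rewrite partial_f_G.
  rewrite partial_mulmx//; last exact: dGam.
  rewrite partial_G mulmxDr; congr (_ + _).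
  by rewrite mulmx_sumr; apply: eq_bigr => m _; rewrite partial_f_G// scalemxAr.
have entry a b : (\sum_m Gam b k x m 0 *: Gam a m x + partial a (Gam b k) x) l 0
    = \sum_m christoffel F l a m x * christoffel F m b k x + (partial a (Gam b k) x) l 0.
  rewrite mxE summxE; congr (_ + _).
  by apply: eq_bigr => m _; rewrite !mxE mulrC.
have := smooth_partialC (f k) (i := i) (j := j) openTT (sf k) (I : setT x).
rewrite !E => /(can_inj (mulKmx (G_unit _ Ux)))/colP/(_ l) H.
rewrite sumrB.
have solve (a b d d' : R) : a + d = b + d' -> d - d' + (a - b) = 0.
  by move/eqP; rewrite -subr_eq0 opprD addrACA addrC => /eqP.
exact: solve (etrans (esym (entry i j)) (etrans H (entry j i))).
Qed.

Lemma normal_section_frame (b : 'rV[R]_n -> 'cV[R]_n) : smooth_on U b ->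
  normal_section U F (fun z => Phi z *m (dn *m b z)).
Proof.
move=> sb; split; first exact: smooth_normal.
by move=> x Ux; apply/is_normal_FP; [exact: hU|exists (b x); rewrite dnE].
Qed.

(** Conversely, every normal section has smooth coordinates in the frame. *)
Lemma normal_section_FP w : normal_section U F w ->
  exists2 b, smooth_on U b & {in U, w =1 fun z => Phi z *m (dn *m b z)}.
Proof.
move=> [sw nw]; exists (fun z => dn^T *m (invmx (Phi z) *m w z)).
  apply: smooth_mulmxl => //; apply: smooth_mulmx => //.
  by apply: (@smooth_subset _ _ _ setT) => //; exact: smooth_inv_in_O.
move=> z; rewrite inE => Uz; have [|b ->] := (is_normal_FP z _ (w z)).1 (nw z Uz).
  exact: hU.
rewrite mulKmx ?in_O_unit// -dnE (mulmxA dn^T) /dn tr_col_mx mul_row_col.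
by rewrite trmx0 mul0mx add0r trmx1 !mul1mx.
Qed.

Lemma nconn_eq_on (w w' : 'rV[R]_n -> 'cV[R]_(n + n)) i x : {in U, w =1 w'} -> U x ->
  nconn F i w x = nconn F i w' x.
Proof. by move=> ww' Ux; rewrite /nconn (partial_eq_on oU ww' Ux). Qed.

(* the normal connection in the frame: the derivative conjugated by [g2] *)
Let transport (b : 'rV[R]_n -> 'cV[R]_n) i z : 'cV[R]_n :=
  invmx (g2 z) *m partial i (fun t => g2 t *m b t) z.

Lemma nconn_frame (b : 'rV[R]_n -> 'cV[R]_n) i x : smooth_on U b -> U x ->
  nconn F i (fun z => Phi z *m (dn *m b z)) x = Phi x *m (dn *m transport b i x).
Proof.
move=> sb Ux; have db := smooth_differentiable sb Ux.
rewrite /nconn partial_normal// npart_F ?dnE; last exact: hU.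
by rewrite /transport partial_g2mul// mulKmx// in_O_unit.
Qed.

(** In the gauge [g2] the normal connection is the trivial one, so its flatness
    is the symmetry of second derivatives. *)
Lemma flat_normal_F : flat_normal_on U F.
Proof.
move=> w /normal_section_FP[b sb wE] i j x Ux.
have sg2b : smooth_on U (fun t => g2 t *m b t).
  by apply: smooth_mulmx => //; apply: smooth_subset sg2.
have st k : smooth_on U (transport b k).
  apply: smooth_mulmx => //; last exact: smooth_partial.
  by apply: (@smooth_subset _ _ _ setT) => //; exact: smooth_inv_in_O.
have nE k : {in U, nconn F k w =1 fun z => Phi z *m (dn *m transport b k z)}.
  move=> z; rewrite inE => Uz; rewrite (nconn_eq_on _ _ k z wE Uz).
  exact: nconn_frame.
have ttE k : (fun t => g2 t *m transport b k t) = partial k (fun t => g2 t *m b t).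
  by apply/funext => t; rewrite /transport mulKVmx// in_O_unit.
have E a k : nconn F a (nconn F k w) x = Phi x *m (dn *m
    (invmx (g2 x) *m partial a (partial k (fun t => g2 t *m b t)) x)).
  have E1 := nconn_eq_on (nconn F k w) _ a x (nE k) Ux.
  have E2 := nconn_frame (transport b k) a x (st k) Ux.
  have E3 : transport (transport b k) a x
      = invmx (g2 x) *m partial a (partial k (fun t => g2 t *m b t)) x.
    by rewrite -(ttE k).
  exact: etrans E1 (etrans E2 (congr1 (fun t => Phi x *m (dn *m t)) E3)).
apply: etrans (E i j) (etrans _ (esym (E j i))).
by rewrite (smooth_partialC (fun t => g2 t *m b t) (i := i) oU sg2b Ux).
Qed.

(* the [i]-th eigenvalue of the shape operator of the normal vector [b] *)
Let lam (b : 'cV[R]_n) i x : R := - (lor (nu i) b / h i x).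

(** The shape operators are simultaneously diagonal in the coordinates. *)
Lemma shape_frame w (b : 'rV[R]_n -> 'cV[R]_n) x :
  {in U, w =1 fun z => Phi z *m (dn *m b z)} -> smooth_on U b -> U x ->
  Defs.shape F w x = diag_mx (\row_i lam (b x) i x).
Proof.
move=> wE sb Ux; have db := smooth_differentiable sb Ux.
apply/row_matrixP => i; rewrite rowK (partial_eq_on oU wE Ux) partial_normal//.
rewrite -mulmxN opp_col_mx tcoord_F; last exact: hU.
apply/rowP => k; rewrite alE !mxE eqxx andbT mulrb; case: eqP => [->|] /=.
  by rewrite eqxx mulr1 mulNr.
by rewrite eq_sym => /eqP/negbTE ->; rewrite mulr0 oppr0 mul0r.
Qed.

Lemma shape_section w x : normal_section U F w -> U x -> exists b, 
  w x = Phi x *m col_mx 0 b /\ Defs.shape F w x = diag_mx (\row_i lam b i x).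
Proof.
move=> /normal_section_FP[b sb wE] Ux; exists (b x).
by rewrite (shape_frame w b)// wE ?inE// dnE.
Qed.

(** Constant coordinates already give all normal vectors at a point. *)
Lemma shape_surj b x : U x -> exists w, [/\ normal_section U F w,
  w x = Phi x *m col_mx 0 b & Defs.shape F w x = diag_mx (\row_i lam b i x)].
Proof.
move=> Ux; exists (fun z => Phi z *m (dn *m cst b z)).
have sb : smooth_on U (cst b : 'rV[R]_n -> 'cV[R]_n) by exact: smooth_cst.
by split; [exact: normal_section_frame|rewrite dnE|rewrite (shape_frame _ (cst b))].
Qed.

Lemma degenerate_normal_F i j : U !=set0 -> i != j -> nu i = nu j ->
  degenerate_normal_on U F.
Proof.
move=> [x Ux] ij nuij /(_ x Ux)[V [dV VP]].
have hij : h i x = h j x by rewrite /h nuij.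
suff : (\dim V < n)%N by rewrite dV ltnn.
apply: (dim_diag_tied ij) => A /VP[w nw ->].
have [b [_ ->]] := shape_section w x nw Ux; eexists; split; first by [].
by rewrite !mxE /lam nuij hij.
Qed.

Hypothesis nu_sep : forall i j (a b : R), nu i != nu j -> a != 0 -> b != 0 ->
  a *: nu i != b *: nu j.

(* the span of the coordinate directions with the same normal direction *)
Let E i : {vspace 'rV[R]_n} := (\sum_(j | nu j == nu i) <[ddx R j]>)%VS.

Lemma mem_E_shape i x X : U x -> (X \in E i <->
  forall w, normal_section U F w -> X *m Defs.shape F w x = (Defs.shape F w x i i) *: X).
Proof.
move=> Ux; rewrite mem_span_ddx; split=> [X0 w nw|XS j ji].
  have [b [_ ->]] := shape_section w x nw Ux.
  apply/rowP => k; rewrite mul_mx_diag !mxE eqxx mulr1n mulrC.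
  have [nuk|/X0 ->] := eqVneq (nu k) (nu i); last by rewrite !mulr0.
  by rewrite /lam /h nuk.
apply/eqP; apply: contraTT isT => Xj; apply/negP => _.
(* otherwise the eigenvalues [lam _ j] and [lam _ i] agree on all normal vectors,
   and the nondegenerate product forces [nu j] and [nu i] to be proportional *)
have lamE b : lam b j x = lam b i x.
  have [w [nw _ sw]] := shape_surj b x Ux.
  have := XS w nw; rewrite sw => /rowP/(_ j).
  rewrite mul_mx_diag !mxE eqxx mulr1n mulrC; exact: mulIf.
have := nu_sep _ _ (h j x)^-1 (h i x)^-1 ji; rewrite !invr_eq0.
move=> /(_ (hU _ Ux j) (hU _ Ux i))/eqP; apply.
apply: lor_nondeg => b; have /oppr_inj := lamE b.
by rewrite !lorZr !(lorC _ b) !(mulrC (_^-1)).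
Qed.

Lemma ddx_mem_E i : ddx R i \in E i.
Proof.
apply/mem_span_ddx => j; apply: contraNeq; rewrite mxE/=.
by case: (j =P i) => [->|_]; rewrite ?eqxx.
Qed.

Lemma curv_distr_FP x V : U x -> (curv_distr U F x V <-> exists i, V = E i).
Proof.
move=> Ux; split=> [[V0 [mu VP]]|[i ->]]; last first.
  split.
    move=> Ei0; have := ddx_mem_E i; rewrite Ei0 memv0 => /eqP/rowP/(_ i).
    by rewrite !mxE !eqxx => /eqP; rewrite oner_eq0.
  exists (fun w => Defs.shape F w x i i) => X; exact: mem_E_shape.
have [X XV X0] : exists2 X, X \in V & X != 0.
  by exists (vpick V); [exact: memv_pick|rewrite vpick0; apply/eqP].
(* a nonzero coordinate of an eigenvector determines the eigenvalue *)
have [i Xi] := rV0Pn _ X0; exists i.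
have muE w : normal_section U F w -> mu w = Defs.shape F w x i i.
  move=> nw; have := (VP X).1 XV w nw; have [b [_ ->]] := shape_section w x nw Ux.
  move=> /rowP/(_ i); rewrite mul_mx_diag !mxE eqxx mulr1n mulrC => /(mulIf Xi) <- //.
apply/vspaceP => Y; apply/idP/idP => [/(VP Y).1|/(mem_E_shape _ _ _ Ux).1] H.
  by apply/(mem_E_shape _ _ _ Ux) => w nw; rewrite H// muE.
by apply/VP => w nw; rewrite H// muE.
Qed.

Lemma curv_normal_FP x V v : U x -> (curv_normal U F x V v <->
  exists i, V = E i /\ v = - (h i x)^-1 *: (Phi x *m col_mx 0 (nu i))).
Proof.
move=> Ux; have nP := is_normal_FP x (hU _ Ux).
have vE i : - (h i x)^-1 *: (Phi x *m col_mx 0 (nu i))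
    = Phi x *m col_mx 0 (- (h i x)^-1 *: nu i).
  by rewrite scalemxAr scale_col_mx scaler0.
split=> [[/(curv_distr_FP _ _ Ux)[i ->] /nP[g ->] vP]|[i [-> ->]]].
  exists i; split => //; rewrite vE; congr (_ *m col_mx _ _).
  apply: lor_nondeg => b; have [w [nw wx sw]] := shape_surj b x Ux.
  have := vP w nw _ (ddx_mem_E i).
  rewrite wx lor_frame mulmx0 mxE add0r sw => /rowP/(_ i).
  rewrite mul_mx_diag !mxE !eqxx mul1r mulr1 => <-.
  by rewrite lorZr lorC mulNr mulrC.
rewrite vE; split.
- by apply/curv_distr_FP => //; exists i.
- by apply/nP; eexists.
- move=> w nw X /(mem_E_shape _ _ _ Ux)/(_ w nw) ->; congr (_ *: _).
  have [b [-> ->]] := shape_section w x nw Ux.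
  rewrite lor_frame mulmx0 !mxE add0r eqxx mulr1n.
  by rewrite lorZr lorC mulNr mulrC.
Qed.

Lemma constant_multiplicities_F : constant_multiplicities_on U F.
Proof.
pose s := undup (codom E).
exists (size s), (fun k => \dim (nth 0%VS s k)) => x Ux.
exists (fun k => nth 0%VS s k); split => //.
- by move=> k k' /eqP; rewrite nth_uniq ?undup_uniq// => /eqP/val_inj.
- move=> V; rewrite curv_distr_FP//; split=> [[i ->]|[k ->]].
    have Es : E i \in s by rewrite mem_undup codom_f.
    by exists (Ordinal (eqbRL (index_mem _ _) Es)); rewrite nth_index.
  have : nth 0%VS s k \in s by exact: mem_nth.
  by rewrite mem_undup => /codomP[i ->]; exists i.
Qed.

Lemma line_of_curvature_F : line_of_curvature_on U F.
Proof.
move=> x Ux i; exists (E i); last exact: ddx_mem_E.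
by apply/curv_distr_FP => //; exists i.
Qed.

Lemma immersion_F : immersion_on U F.
Proof.
split; first exact: smooth_subset smooth_F.
by move=> x Ux; apply: diff_F_inj; exact: hU.
Qed.

Lemma lightcone_F x : lor c c = 0 -> U x -> in_lightcone (F x).
Proof.
move=> c0 Ux; split.
  rewrite lor_frame mulmx0 mxE add0r -(lor_in_O _ _ _ _ (og2 x)) /y mulKVmx//.
  exact: in_O_unit.
apply/eqP => F0; have /frame_inj[_ y0] : F x = Phi x *m col_mx 0 0.
  by rewrite F0 col_mx0 mulmx0.
by have := hU _ Ux (Ordinal n0); rewrite /h y0 lor0r eqxx.
Qed.

End Open.

End Frame.

(** * The abelian subalgebra and its frames *)

Section Directions.
Context {R : realType} {n p : nat} (hnp : (1 < n - p)%N).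
Implicit Types (i j : 'I_n).

(** The directions [nu_i] of [a_p]: the [i]-th basis vector for the first [p]
    indices, and the fixed null vector [e_(n-1) + e_n] for all the others. *)
Definition direction i : 'cV[R]_n :=
  if (i < p)%N then delta_mx i 0
  else delta_mx (penult hnp) 0 + delta_mx (ultim hnp) 0.

Lemma penult_ge : (p <= penult hnp)%N.
Proof. by rewrite /=; move: hnp; lia. Qed.

Lemma ultim_ge : (p <= ultim hnp)%N.
Proof. by rewrite /=; move: hnp; lia. Qed.

Lemma penult_neq : penult hnp != ultim hnp.
Proof. by rewrite -val_eqE/=; move: hnp; lia. Qed.

Lemma delta_mulmx_Ilor m (k : 'I_m) j :
  delta_mx k j *m Ilor R n = (if j.+1 == n then -1 else 1) *: delta_mx k j.
Proof.
apply/matrixP => a b; rewrite mul_mx_diag !mxE mulrC.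
by have [->|] := eqVneq b j; rewrite ?andbF ?mulr0// => _.
Qed.

Lemma sgn_lt i : (i < p)%N -> (i.+1 == n :> nat) = false.
Proof. by move: hnp => /[swap]; lia. Qed.

Lemma sgn_penult : ((penult hnp).+1 == n :> nat) = false.
Proof. by rewrite /=; move: hnp; lia. Qed.

Lemma sgn_ultim : ((ultim hnp).+1 == n :> nat).
Proof. by rewrite /=; move: hnp; lia. Qed.

Lemma tr_direction_Ilor i : (direction i)^T *m Ilor R n
  = if (i < p)%N then delta_mx 0 i else delta_mx 0 (penult hnp) - delta_mx 0 (ultim hnp).
Proof.
rewrite /direction; case: ifP => ip.
  by rewrite trmx_delta delta_mulmx_Ilor sgn_lt// scale1r.
rewrite linearD/= !trmx_delta mulmxDl !delta_mulmx_Ilor sgn_penult sgn_ultim.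
by rewrite scale1r scaleN1r.
Qed.

Lemma lor_direction i (y : 'cV[R]_n) : lor (direction i) y
  = if (i < p)%N then y i 0 else y (penult hnp) 0 - y (ultim hnp) 0.
Proof.
rewrite /lor tr_direction_Ilor; case: ifP => _; first by rewrite -rowE mxE.
by rewrite mulmxBl -!rowE !mxE.
Qed.

(** The generators of [a_p] have the rank-one blocks given by the directions. *)
Lemma a_gen_blocks i : a_gen R hnp i
  = block_mx 0 (tangent_block direction i) (normal_block direction i) 0.
Proof.
rewrite /a_gen /tangent_block tr_direction_Ilor /normal_block /direction.
case: ifP => ip; congr block_mx.
- by rewrite mul_delta_mx.
- by rewrite trmx_delta mul_delta_mx -(tr_Ilor n) -[delta_mx i i]trmxK -trmx_mul
    trmx_delta delta_mulmx_Ilor sgn_lt// scale1r.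
- by rewrite mulmxBr !mul_delta_mx.
- by rewrite trmx_delta mulmxDl !mul_delta_mx.
Qed.

Lemma direction_entry i j : (i < p)%N -> direction j i 0 = (j == i)%:R.
Proof.
move=> ip; have ineq (k : 'I_n) : (p <= k)%N -> (i == k) = false.
  by move=> pk; apply/negbTE; rewrite -val_eqE/= ltn_eqF// (leq_trans ip).
rewrite /direction; case: ifP => jp; first by rewrite mxE eqxx andbT eq_sym.
rewrite !mxE !ineq ?penult_ge ?ultim_ge// addr0.
by rewrite eq_sym ineq// leqNgt jp.
Qed.

Lemma direction_eq i j : (i < p)%N -> (direction j == direction i) = (j == i).
Proof.
move=> ip; apply/eqP/eqP => [|->//] /colP/(_ i).
by rewrite !direction_entry// eqxx; case: eqP => // _ /eqP; rewrite eq_sym oner_eq0.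
Qed.

Lemma direction_eq_ge i j : (p <= i)%N -> (direction j == direction i) = (p <= j)%N.
Proof.
move=> pi; have [jp|pj] := ltnP j p.
  rewrite eq_sym direction_eq//; apply/negbTE; rewrite -val_eqE/= gtn_eqF//.
  exact: leq_trans pi.
by rewrite /direction !ltnNge pi pj eqxx.
Qed.

(** Different directions are not proportional: the coordinate of an index below
    [p] separates them. *)
Lemma direction_sep i j (a b : R) : direction i != direction j ->
  a != 0 -> b != 0 -> a *: direction i != b *: direction j.
Proof.
have main (k l : 'I_n) (s t : R) : (k < p)%N -> direction k != direction l -> s != 0 ->
    s *: direction k <> t *: direction l.
  move=> kp; rewrite eq_sym direction_eq// => lk s0 /colP/(_ k).
  rewrite !mxE !direction_entry// eqxx (negbTE lk) mulr1 mulr0.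
  by move/eqP; rewrite (negbTE s0).
move=> ij a0 b0; apply/eqP; have [ip|pi] := ltnP i p; first exact: main.
have [jp|pj] := ltnP j p; first by move/esym; apply: main; rewrite // eq_sym.
by rewrite direction_eq_ge// pi in ij.
Qed.

End Directions.
Arguments direction R {n p} hnp i.

Lemma tau_block {K : comUnitRingType} {n} (a b c d : 'M[K]_n) :
  tau (block_mx a b c d) = block_mx a (- b) (- c) d.
Proof.
have rho2 : rho K n *m rho K n = 1%:M.
  rewrite /rho mulmx_block !mul0mx !mulmx0 mul1mx mulNmx mulmxN opprK mul1mx.
  by rewrite !addr0 add0r -scalar_mx_block.
rewrite /tau; have -> : invmx (rho K n) = rho K n.
  by rewrite -[LHS]mulmx1 -rho2 mulmxA mulVmx ?mul1mx//; case/mulmx1_unit: rho2.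
rewrite /rho !mulmx_block !mul0mx !mulmx0 !addr0 !add0r !mulmxN !mulNmx !opprK.
by rewrite !mul1mx !mulmx1 ?mulmx0 ?mul0mx ?oppr0 ?addr0 ?add0r.
Qed.

Section RealFrame.
Context {R : realType} {n : nat}.
Local Notation "r %:C" := (real_complex R r) (format "r %:C").

Lemma mxC_mul m (A A' : 'M[R]_m) : mxC (A *m A') = mxC A *m mxC A'.
Proof. exact: map_mxM. Qed.

Lemma mxC_Re m (A : 'M[R[i]]_m) : mxconj A = A -> mxC (mxRe A) = A.
Proof.
move=> /matrixP rA; apply/matrixP => a b; have := rA a b; rewrite !mxE.
case: (A a b) => u v [] vN; congr Complex; rewrite /=; lra.
Qed.

Lemma mxRe_C m (A : 'M[R]_m) : mxRe (mxC A) = A.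
Proof. by apply/matrixP => a b; rewrite !mxE. Qed.

Lemma in_O_mxC m (P : 'M[R]_m) : in_O (mxC P) -> in_O P.
Proof.
have JC : Ilor R[i] m = mxC (Ilor R m).
  apply/matrixP => a b; rewrite !mxE rmorphMn/=; congr (_ *+ _).
  by case: ifP => _; rewrite ?rmorphN rmorph1.
have TC : (mxC P)^T = mxC P^T by apply/matrixP => a b; rewrite !mxE.
by rewrite /in_O JC TC -!mxC_mul => /(congr1 (@mxRe R m)); rewrite !mxRe_C.
Qed.

Lemma mxRe_partialC m (f : 'rV[R]_n -> 'M[R[i]]_m) i x :
  mxRe (partialC i f x) = partial i (fun z => mxRe (f z)) x.
Proof. by apply/matrixP => a b; rewrite !mxE. Qed.

(** At a real parameter the reality condition makes the frame real, and its real
    part satisfies the real linear system. *)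
Lemma real_frame p (hnp : (1 < n - p)%N) Xi Phi (r : R) :
  extended_flat_frame hnp Xi Phi ->
  exists P : 'rV[R]_n -> 'M[R]_(n + n),
  [/\ forall x, Phi x r%:C = mxC (P x), forall x, in_O (P x), smooth_on setT P &
      forall i x, partial i P x
        = P x *m (r *: a_gen R hnp i + lie (a_gen R hnp i) (Xi x))].
Proof.
move=> [oPhi sPhi dPhi rPhi _]; pose P x := mxRe (Phi x r%:C).
have PE x : Phi x r%:C = mxC (P x).
  by rewrite mxC_Re// rPhi; congr (Phi x _); rewrite /= oppr0.
have oP x : in_O (P x) by apply: in_O_mxC; rewrite -PE.
exists P; split => //; first exact: (sPhi _).1.
move=> i x; rewrite -mxRe_partialC.
have uP : Phi x r%:C \in unitmx.
  by rewrite PE /mxC map_unitmx; exact: in_O_unit.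
have := dPhi r%:C i x => /(congr1 (mulmx (Phi x r%:C))); rewrite mulKVmx// => ->.
have -> : lax hnp Xi r%:C i x = mxC (r *: a_gen R hnp i + lie (a_gen R hnp i) (Xi x)).
  rewrite /lax; move: (lie (a_gen R hnp i) (Xi x)) (a_gen R hnp i) => L A.
  by apply/matrixP => a b; rewrite !mxE -rmorphM -rmorphD.
by rewrite PE -mxC_mul mxRe_C.
Qed.

(** Elements fixed by the involution are block diagonal. *)
Lemma tau_fixed_block (A : 'M[R]_(n + n)) :
  tau (mxC A) = mxC A -> A = block_mx (ulsubmx A) 0 0 (drsubmx A).
Proof.
rewrite -[in mxC A](submxK A) /mxC map_block_mx tau_block.
move=> /eq_block_mx[_ E1 E2 _].
have zero (Z : 'M[R]_n) : - map_mx (real_complex R) Z = map_mx (real_complex R) Z -> Z = 0.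
  move=> /matrixP E; apply/matrixP => a b; have := E a b; rewrite !mxE => -[] H _; lra.
by rewrite -{1}(submxK A) (zero _ E1) (zero _ E2).
Qed.

End RealFrame.

Lemma ulsubmx_mul {R : pzRingType} {n} (A : 'M[R]_(n + n)) :
  ulsubmx A = row_mx 1%:M 0 *m (A *m col_mx 1%:M 0).
Proof.
rewrite -{2}(submxK A) mul_block_col !mulmx0 !addr0 !mulmx1 mul_row_col.
by rewrite mul1mx mul0mx addr0.
Qed.

Lemma drsubmx_mul {R : pzRingType} {n} (A : 'M[R]_(n + n)) :
  drsubmx A = row_mx 0 1%:M *m (A *m col_mx 0 1%:M).
Proof.
rewrite -{2}(submxK A) mul_block_col !mulmx0 !add0r !mulmx1 mul_row_col.
by rewrite mul1mx mul0mx add0r.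
Qed.

Lemma smooth_submx {R : realType} {n m k l o} (A : 'M[R]_(m, k)) (B : 'M[R]_(l, o))
    (f : 'rV[R]_n -> 'M[R]_(k, l)) :
  smooth_on setT f -> smooth_on setT (fun z => A *m (f z *m B)).
Proof.
move=> sf; apply: smooth_mulmxl; first exact: openT.
apply: (smooth_mulmx _ (cst B)) => //; [exact: openT|exact: smooth_cst].
Qed.

Lemma partial_submx {R : realType} {n m k l o} (A : 'M[R]_(m, k)) (B : 'M[R]_(l, o))
    (f : 'rV[R]_n -> 'M[R]_(k, l)) i x : smooth_on setT f ->
  partial i (fun z => A *m (f z *m B)) x = A *m (partial i f x *m B).
Proof.
move=> sf; have df : differentiable f x by exact: smooth_differentiable sf _.
have dB : differentiable (cst B : 'rV[R]_n -> 'M[R]_(l, o)) x by exact: differentiable_cst.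
rewrite partial_mulmxl; last exact: (differentiable_mulmx f (cst B)).
by rewrite (partial_mulmx f (cst B))// partial_cst mulmx0 addr0.
Qed.

(** The frame at the parameter 1 is adapted.  The brackets [[a_i, Xi]] of two
    elements of [p] are block diagonal, and are the logarithmic derivatives of the
    frame at the parameter 0, which [tau] fixes. *)
Lemma frame_adapted {R : realType} {n p : nat} (hnp : (1 < n - p)%N)
    (Xi : 'rV[R]_n -> 'M[R]_(n + n)) (Phi : 'rV[R]_n -> R[i] -> 'M[R[i]]_(n + n)) :
  (forall x, in_p (Xi x)) -> extended_flat_frame hnp Xi Phi ->
  exists (Phi1 : 'rV[R]_n -> 'M[R]_(n + n)) (g1 g2 : 'rV[R]_n -> 'M[R]_n)
    (B C : 'I_n -> 'rV[R]_n -> 'M[R]_n),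
  [/\ forall x, Phi x 0 = mxC (block_mx (g1 x) 0 0 (g2 x)),
      forall x, Phi x 1 = mxC (Phi1 x) &
      adapted_frame (direction R hnp) Phi1 g1 g2 B C].
Proof.
move=> pXi eff; have n0 : (0 < n)%N := leq_trans (ltnW hnp) (leq_subr p n).
have [Phi1 [Phi1E oPhi1 sPhi1 dPhi1]] := real_frame p hnp Xi Phi 1 eff.
have [Phi0 [Phi0E oPhi0 sPhi0 dPhi0]] := real_frame p hnp Xi Phi 0 eff.
have Phi0b x : Phi0 x = block_mx (ulsubmx (Phi0 x)) 0 0 (drsubmx (Phi0 x)).
  apply: tau_fixed_block; rewrite -Phi0E.
  by have [_ _ _ _ ->] := eff; rewrite -rmorphN oppr0.
pose L i x := lie (a_gen R hnp i) (Xi x).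
pose B i x : 'M[R]_n := ulsubmx (L i x); pose C i x : 'M[R]_n := drsubmx (L i x).
have LE i x : L i x = block_mx (B i x) 0 0 (C i x).
  rewrite /B /C /L /lie; have [xi ->] := pXi x; rewrite a_gen_blocks.
  rewrite !mulmx_block !mul0mx !mulmx0 !addr0 !add0r opp_block_mx add_block_mx.
  by rewrite !oppr0 !addr0 block_mxKul block_mxKdr.
exists Phi1, (fun x => ulsubmx (Phi0 x)), (fun x => drsubmx (Phi0 x)), B, C.
have oB x : (ulsubmx (Phi0 x))^T *m ulsubmx (Phi0 x) = 1%:M /\ in_O (drsubmx (Phi0 x)).
  have := oPhi0 x; have := Phi0b x; move: (ulsubmx _) (drsubmx _) => a d ->.
  rewrite /in_O Ilor_block// tr_block_mx !mulmx_block.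
  rewrite !trmx0 !mul0mx !mulmx0 !addr0 !add0r !mul0mx !mulmx1.
  by move=> /eq_block_mx[-> _ _ ->].
split.
- by move=> x; rewrite -Phi0b -Phi0E.
- by move=> x; rewrite -Phi1E.
split => //.
- by under eq_fun do rewrite ulsubmx_mul; exact: smooth_submx.
- by under eq_fun do rewrite drsubmx_mul; exact: smooth_submx.
- by move=> x; exact: (oB x).1.
- by move=> x; exact: (oB x).2.
- move=> i x; rewrite dPhi1 -/(L i x) LE a_gen_blocks scale1r add_block_mx.
  by rewrite !addr0 !add0r.
- move=> i x; under eq_fun do rewrite ulsubmx_mul.
  rewrite partial_submx// -ulsubmx_mul dPhi0 -/(L i x) LE scale0r add0r Phi0b.
  by rewrite mulmx_block !mul0mx !mulmx0 !addr0 !block_mxKul.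
- move=> i x; under eq_fun do rewrite drsubmx_mul.
  rewrite partial_submx// -drsubmx_mul dPhi0 -/(L i x) LE scale0r add0r Phi0b.
  by rewrite mulmx_block !mul0mx !mulmx0 !add0r !block_mxKdr.
Qed.

(** * The immersion of an extended flat frame *)

Theorem theorem6p3 (R : realType) (n p : nat) (hnp : (1 < n - p)%N)
    (Xi : 'rV[R]_n -> 'M[R]_(n + n)) (hXi : UK_solution hnp Xi)
    (c : 'cV[R]_n) (hc : lor c c = 0)
    (Phi : 'rV[R]_n -> R[i] -> 'M[R[i]]_(n + n))
    (hPhi : extended_flat_frame hnp Xi Phi) :
  exists (g1 g2 : 'rV[R]_n -> 'M[R]_n) (Phi1 : 'rV[R]_n -> 'M[R]_(n + n)),
  [/\ forall x, Phi x 0 = mxC (block_mx (g1 x) 0 0 (g2 x)),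
      forall x, Phi x 1 = mxC (Phi1 x) &
      let y : 'rV[R]_n -> 'cV[R]_n := fun x => invmx (g2 x) *m c in
      let z := fun x => y x (penult hnp) 0 - y x (ultim hnp) 0 in
      let u := fun (i : 'I_n) x => col (rshift n i) (Phi1 x) in
      let v : 'rV[R]_n -> 'cV[R]_(n + n) := fun x => u (penult hnp) x + u (ultim hnp) x in
      let F := fun x => Phi1 x *m col_mx 0 (y x) in
      forall U : set 'rV[R]_n, open U -> U !=set0 ->
        (forall x, U x -> forall i : 'I_n, (i < p)%N -> y x i 0 != 0) ->
        (forall x, U x -> z x != 0) ->
      [/\ (forall x, U x -> in_lightcone (F x)) /\ immersion_on U F,
          flat_metric_on U F,
          flat_normal_on U F /\ degenerate_normal_on U F,
          constant_multiplicities_on U F /\ line_of_curvature_on U F &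
          forall x, U x ->
          [/\ forall X Y : 'rV[R]_n,
                fff F x X Y
                = \sum_(i < n | (i < p)%N) y x i 0 ^+ 2 * (X 0 i * Y 0 i)
                  + \sum_(j < n | (p <= j)%N) z x ^+ 2 * (X 0 j * Y 0 j),
              forall X Y : 'rV[R]_n,
                sff F x X Y
                = - (\sum_(i < n | (i < p)%N)
                        (y x i 0 * (X 0 i * Y 0 i)) *: u i x
                     + \sum_(j < n | (p <= j)%N)
                        (z x * (X 0 j * Y 0 j)) *: v x) &
              forall (E : {vspace 'rV[R]_n}) (w : 'cV[R]_(n + n)),
                curv_normal U F x E w <->
                (exists i : 'I_n, [/\ (i < p)%N, E = <[ddx R i]>%VS
                                    & w = - (y x i 0)^-1 *: u i x])
                \/ (E = (\sum_(j < n | (p <= j)%N) <[ddx R j]>)%VS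
                    /\ w = - (z x)^-1 *: v x)]]].

Proof.
have [_ pXi _] := hXi.
have [Phi1 [g1 [g2 [B [C [Phi0E Phi1E fr]]]]]] :=
  frame_adapted hnp Xi Phi (fun x => (pXi x).1) hPhi.
exists g1, g2, Phi1; split; [exact: Phi0E|exact: Phi1E|move=> y z u v F U oU U0 yU zU].
have n0 : (0 < n)%N := leq_trans (ltnW hnp) (leq_subr p n).
pose nu := direction R hnp.
(* the Lame coefficients are the [y_i] for the first [p] indices, then [z] *)
have hE i x : lor (nu i) (y x) = if (i < p)%N then y x i 0 else z x.
  exact: lor_direction.
have hU x : U x -> forall i, lor (nu i) (y x) != 0.
  by move=> Ux i; rewrite hE; case: ifP => ip; [exact: yU|exact: zU].
have uE x i : u i x = Phi1 x *m col_mx 0 (delta_mx i 0).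
  rewrite /u colE; congr (_ *m _); apply/colP => k; rewrite -(fintype.splitK k).
  case: (fintype.split k) => l /=.
    by rewrite col_mxEu !mxE eqxx andbT eq_lrshift.
  by rewrite col_mxEd !mxE (inj_eq (@rshift_inj _ _)).
have vE x : v x = Phi1 x *m col_mx 0 (nu (ultim hnp)).
  rewrite /v !uE -mulmxDr add_col_mx addr0 /nu /direction ltnNge.
  by rewrite (ultim_ge hnp).
have nuE i x : Phi1 x *m col_mx 0 (nu i) = if (i < p)%N then u i x else v x.
  case: ifP => ip; first by rewrite uE /nu /direction ip.
  rewrite vE; congr (_ *m col_mx _ _); apply/eqP.
  by rewrite direction_eq_ge ?ultim_ge// leqNgt ip.
have split_sum (W : nmodType) (f : 'I_n -> W) :
    \sum_i f i = \sum_(i < n | (i < p)%N) f i + \sum_(j < n | (p <= j)%N) f j.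
  rewrite (bigID (fun i : 'I_n => (i < p)%N))/=; congr (_ + _).
  by apply: eq_bigl => j; rewrite -leqNgt.
split.
- split; last exact: (immersion_F fr hU).
  by move=> x; exact: (lightcone_F n0 fr hU).
- exact: (flat_metric_F n0 fr oU hU).
- split; first exact: (flat_normal_F n0 fr oU hU).
  apply: (degenerate_normal_F n0 fr oU hU _ _ U0 (penult_neq hnp)) => //.
  by apply/eqP; rewrite direction_eq_ge; [exact: penult_ge|exact: ultim_ge].
- split; first exact: (constant_multiplicities_F n0 fr oU hU (direction_sep hnp)).
  exact: (line_of_curvature_F n0 fr oU hU (direction_sep hnp)).
move=> x Ux; split.
- move=> X Y; rewrite (fff_F n0 fr) split_sum; congr (_ + _).
    by apply: eq_bigr => i ip; rewrite hE ip.
  by apply: eq_bigr => j pj; rewrite hE ltnNge pj.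
- move=> X Y; rewrite (sff_F n0 fr x (hU x Ux)) split_sum; congr (- (_ + _)).
    by apply: eq_bigr => i ip; rewrite hE nuE ip.
  by apply: eq_bigr => j pj; rewrite hE nuE ltnNge pj.
move=> E w; rewrite (curv_normal_FP n0 fr oU hU (direction_sep hnp))//.
have E_lt (i : 'I_n) : (i < p)%N -> (\sum_(j | nu j == nu i) <[ddx R j]>)%VS = <[ddx R i]>%VS.
  by move=> ip; under eq_bigl do rewrite direction_eq//; rewrite big_pred1_eq.
have E_ge (i : 'I_n) : (p <= i)%N -> (\sum_(j | nu j == nu i) <[ddx R j]>)%VS
    = (\sum_(j < n | (p <= j)%N) <[ddx R j]>)%VS.
  by move=> pi; under eq_bigl do rewrite direction_eq_ge//.
split=> [[i [-> ->]]|[[i [ip -> ->]]|[-> ->]]].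
- have [ip|pi] := ltnP i p.
    by left; exists i; rewrite E_lt// hE nuE ip.
  by right; rewrite E_ge// hE nuE ltnNge pi.
- by exists i; rewrite E_lt// hE nuE ip.
- exists (ultim hnp); rewrite E_ge ?ultim_ge// hE nuE.
  by rewrite ltnNge (ultim_ge hnp).
Qed.
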